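(* Let $\lambda$ be a positive integer, $n\ge0$ an integer, and for integers $m\ge0$ let \[ I_{m,n}^{(\lambda)}=\int_0^\pi \cos(2m\theta)\,\log\big(C_n^{(\lambda)}(\cos\theta)\big)^2\,\mathrm{d}\theta . \] Then \[ I_{0,n}^{(\lambda)}=2\pi\log\left(\frac{(\lambda)_n}{n!}\right), \] and for $m\ge1$, \[ I_{m,n}^{(\lambda)}=\frac{(2\lambda-1)\pi}{m}+\frac{\pi}{(2m)!}\,\frac{d^{2m}}{dz^{2m}}\left.\left(\log\sum_{\nu=0}^{\lambda-1}\alpha_{\nu,n}^{(\lambda)}\big(z^{2n+2\lambda+2\nu}-z^{2\lambda-2\nu-2}\big)\right)\right|_{z=0}. \]
   Context: $C_n^{(\lambda)}(x)$ denotes the Gegenbauer polynomial of degree $n$ and parameter $\lambda$, defined by $(1-2xt+t^2)^{-\lambda}=\sum_{n\ge0}C_n^{(\lambda)}(x)t^n$. $(a)_k=\Gamma(a+k)/\Gamma(a)$ is the Pochhammer symbol, and $\alpha_{\nu,n}^{(\lambda)}=\dfrac{(1-\lambda)_\nu (n+1)_\nu}{\nu!\,(n+\lambda+1)_\nu}$. The polynomial $p(z)=\sum_{\nu=0}^{\lambda-1}\alpha_{\nu,n}^{(\lambda)}(z^{2n+2\lambda+2\nu}-z^{2\lambda-2\nu-2})$ satisfies $p(0)=-\alpha_{\lambda-1,n}^{(\lambda)}\neq0$, so $\log p(z)$ is holomorphic near $z=0$ for any choice of branch and its derivatives of order $\ge1$ at $0$ do not depend on the branch. *)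

(* Defs.v *)
From HB Require Import structures.
From mathcomp Require Import all_boot all_order all_algebra.
From mathcomp Require Import all_classical all_reals all_analysis.
Set Implicit Arguments. Unset Strict Implicit. Unset Printing Implicit Defensive.
Import Order.TTheory GRing.Theory Num.Theory.
Import numFieldNormedType.Exports.
Local Open Scope ring_scope.

Definition pochhammer {R : pzRingType} (a : R) (k : nat) : R :=
  \prod_(i < k) (a + i%:R).

(* Gegenbauer polynomial via its generating function:
   C_n^(lam)(x) is the n-th Taylor coefficient at t = 0 of
   t |-> (1 - 2 x t + t^2)^(-lam) (lam a positive integer here). *)
Definition gegenbauer {R : realType} (lam n : nat) (x : R) : R :=
  derive1n n (fun t : R => (1 - 2 * x * t + t ^+ 2) ^- lam) 0 / n`!%:R.

Definition alpha {R : realType} (lam nu n : nat) : R :=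
  pochhammer (1 - lam%:R) nu * pochhammer (n.+1)%:R nu
  / (nu`!%:R * pochhammer (n + lam).+1%:R nu).

Definition pz {R : realType} (lam n : nat) (z : R) : R :=
  \sum_(nu < lam) alpha lam nu n *
     (z ^+ (2 * n + 2 * lam + 2 * nu) - z ^+ (2 * lam - 2 * nu - 2)).

Definition Iintegrand {R : realType} (lam n m : nat) (t : R) : R :=
  cos ((2 * m)%:R * t) * ln ((gegenbauer lam n (cos t)) ^+ 2).

Definition Iset {R : realType} : set R := `[0, pi]%classic.

Definition Imn {R : realType} (lam n m : nat) : \bar R :=
  (\int[@lebesgue_measure R]_(t in Iset) (Iintegrand lam n m t)%:E)%E.

(* Main.v *)
(* [C_n^(l+1)] is, up to a constant, the [l]-th derivative of the Chebyshev
   polynomial [U_(n+l)], so by Rolle's theorem its [n] zeros are real and of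
   the form [cos phi] with [0 < phi < pi].

   On the integral side, [(2 (cos t - cos phi))^2] is the product of the
   squared chords [2 - 2 cos (t + phi)] and [2 - 2 cos (t - phi)]. By evenness
   and periodicity this reduces everything to the Fourier coefficients
   [int_0^pi cos (j u) ln (2 - 2 cos u) du], which are [0] for [j = 0]
   (duplication formula) and [- pi / j] for [j > 0] (integration by parts and
   the Dirichlet kernel). Hence, for [m > 0],
   [I_m = - pi / m * sum_phi cos (2 m phi)].

   On the Taylor side, [p z] is a nonzero constant times
   [(z^2 - 1)^(2 l + 1) z^n C_n^(l+1) ((z + z^-1) / 2)], by induction on [l]
   through [(C_(n+1)^(l))' = 2 l C_n^(l+1)]. So [p z] is a constant times
   [(z^2 - 1)^(2 l + 1) prod_phi (1 - 2 z cos phi + z^2)], and the Taylor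
   coefficients of [ln (1 - 2 z cos phi + z^2)] are [- 2 cos (k phi) / k]. *)

Require Import Defs.
From HB Require Import structures.
From mathcomp Require Import all_boot all_order all_algebra.
From mathcomp Require Import all_classical all_reals all_analysis.
From mathcomp Require Import polyrcf measurable_realfun ring lra zify.
Set Implicit Arguments.
Unset Strict Implicit.
Unset Printing Implicit Defensive.
Import Order.TTheory GRing.Theory Num.Theory.
Import numFieldNormedType.Exports.
Local Open Scope ring_scope.

(** * Polynomials *)

Lemma poly_eq_off (R : numDomainType) (a : R) (p q : {poly R}) :
  (forall x, x != a -> p.[x] = q.[x]) -> p = q.
Proof.
move=> pq; pose d := (p - q) * ('X - a%:P).
have root_d x : root d x.
  rewrite rootE hornerM hornerXsubC hornerD hornerN mulf_eq0 !subr_eq0.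
  by have [->|/pq->] := eqVneq x a; rewrite ?eqxx ?orbT.
have /eqP : d = 0.
  apply: (@roots_geq_poly_eq0 _ _ [seq k%:R | k <- iota 0 (size d)]).
  - by apply/allP => x _; exact: root_d.
  - by rewrite map_inj_uniq ?iota_uniq // => j k /eqP; rewrite eqr_nat => /eqP.
  - by rewrite size_map size_iota.
by rewrite mulf_eq0 polyXsubC_eq0 orbF subr_eq0 => /eqP.
Qed.

Lemma deriv_nderivn (R : nzRingType) k (p : {poly R}) :
  (p^`N(k))^`() = p^`N(k.+1) *+ k.+1.
Proof.
apply/polyP => i; rewrite coef_deriv coefMn !coef_nderivn addSnnS -!mulrnA.
by congr (_ *+ _); rewrite [RHS]mulnC mul_bin_left addKn mulnC.
Qed.

Section RolleRoots.
Context {R : rcfType}.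
Implicit Types (p : {poly R}) (s t : seq R) (i : interval R).

Lemma deriv_roots p i s : sorted <%R s -> all (root p) s -> all (mem i) s ->
  exists t, [/\ size t = (size s).-1, sorted <%R t, all (root p^`()) t &
                all (mem i) t].
Proof.
case: s => [|x s]; first by exists [::].
suff path_roots y : path <%R y s -> all (root p) (y :: s) ->
    all (mem i) (y :: s) ->
    exists t, [/\ size t = size s, path <%R y t, all (root p^`()) t
                & all (mem i) t].
  move=> xs ps i_s; have [t [st xt pt ti]] := path_roots x xs ps i_s.
  by exists t; split=> //; exact: path_sorted xt.
elim: s y {x} => [|z s IH] y; first by exists [::].
move=> /= /andP[yz zs] /and3P[py pz ps] /and3P[yi zi si].
have [||t [st zt pt ti]] := IH z zs; [exact/andP|exact/andP|].
have [c /[!in_itv]/= /andP[yc cz] dc] : {c | c \in `]y, z[ & p^`().[c] = 0}.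
  by apply: poly_rolle; rewrite // (rootP py) (rootP pz).
exists (c :: t); split => /=.
- by rewrite st.
- by rewrite yc; case: t zt {st pt ti} => //= u t /andP[/(lt_trans cz) -> ->].
- by rewrite rootE dc eqxx.
- by rewrite ti andbT; apply: (interval_is_interval yi zi); rewrite !ltW.
Qed.

Lemma derivn_roots p i k s : sorted <%R s -> all (root p) s -> all (mem i) s ->
  exists t, [/\ size t = (size s - k)%N, sorted <%R t, all (root p^`(k)) t &
                all (mem i) t].
Proof.
elim: k => [|k IH] ss ps si; first by exists s; rewrite subn0.
have [t [st tt pt ti]] := IH ss ps si.
have [u [su uu pu ui]] := deriv_roots tt pt ti.
by exists u; rewrite su st subnS derivnS.
Qed.

End RolleRoots.

(* [chebyshevU n] is the Chebyshev polynomial of the second kind usually written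
   [U_(n-1)]. *)
Fixpoint chebyshevU (R : nzRingType) (n : nat) : {poly R} :=
  if n is n1.+1 then
    if n1 is n2.+1 then 2 *: ('X * chebyshevU R n1) - chebyshevU R n2 else 1
  else 0.

Lemma chebyshevUSS (R : nzRingType) n :
  chebyshevU R n.+2 = 2 *: ('X * chebyshevU R n.+1) - chebyshevU R n.
Proof. by []. Qed.

Arguments chebyshevU : simpl never.

Lemma nat_ind2 (P : nat -> Prop) :
  P 0%N -> P 1%N -> (forall n, P n -> P n.+1 -> P n.+2) -> forall n, P n.
Proof.
move=> P0 P1 IH n; suff [] : P n /\ P n.+1 by [].
by elim: n => [|n [Pn PSn]]; split => //; exact: IH.
Qed.

Lemma size_chebyshevU_leq (R : nzRingType) n : (size (chebyshevU R n) <= n)%N.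
Proof.
elim/nat_ind2: n => [||n IHn IHSn]; rewrite ?size_poly0 ?size_poly1 //.
rewrite chebyshevUSS (leq_trans (size_polyD _ _)) // geq_max size_polyN.
rewrite (leq_trans IHn) ?andbT; last by rewrite ltnW.
rewrite (leq_trans (size_scale_leq _ _)) // (leq_trans (size_polyMleq _ _)) //.
by rewrite size_polyX.
Qed.

Lemma coef_chebyshevU (R : nzRingType) n : (chebyshevU R n.+1)`_n = 2 ^+ n.
Proof.
elim: n => [|n IHn]; first by rewrite coefC.
rewrite chebyshevUSS coefB coefZ coefXM /= IHn.
by rewrite [_`_n.+1]nth_default ?subr0 ?exprS // leqW // size_chebyshevU_leq.
Qed.

Lemma nderivn_chebyshevU (R : comNzRingType) k n :
  (chebyshevU R n.+2)^`N(k.+1) =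
  2 *: (chebyshevU R n.+1)^`N(k) + (2 *: 'X) * (chebyshevU R n.+1)^`N(k.+1)
  - (chebyshevU R n)^`N(k.+1).
Proof.
rewrite chebyshevUSS nderivnB nderivnZ; congr (_ - _).
have := nderivnMXaddC k (chebyshevU R n.+1) 0.
by rewrite addr0 mulrC => ->; rewrite scalerDr mulrC scalerAl.
Qed.

Lemma sin_chebyshevU (R : realType) n (t : R) :
  sin t * (chebyshevU R n).[cos t] = sin (n%:R * t).
Proof.
elim/nat_ind2: n => [||n IHn IHSn].
- by rewrite horner0 mul0r mulr0 sin0.
- by rewrite hornerC mulr1 mul1r.
rewrite chebyshevUSS hornerD hornerN hornerZ hornerM hornerX mulrBr IHn.
rewrite mulrCA [sin t * _]mulrCA IHSn.
have -> : n.+2%:R * t = n.+1%:R * t + t by rewrite -natr1; ring.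
have -> : n%:R * t = n.+1%:R * t - t by rewrite -natr1; ring.
by rewrite sinB sinD; ring.
Qed.

(* The identity [sin t * U_n (cos t) = sin ((n + 1) t)] at [z = e^(i t)]. *)
Lemma chebyshevU_joukowski (R : numFieldType) n (z : R) : z != 0 ->
  (z - z^-1) * (chebyshevU R n).[(z + z^-1) / 2] = z ^+ n - z ^- n.
Proof.
move=> z0; elim/nat_ind2: n => [||n IHn IHSn].
- by rewrite horner0 mulr0 expr0 invr1 subrr.
- by rewrite hornerC mulr1.
rewrite chebyshevUSS hornerD hornerN hornerZ hornerM hornerX mulrBr IHn.
rewrite mulrCA [(_ - _) * _]mulrCA IHSn !exprS.
by field; rewrite z0 expf_neq0.
Qed.

(** * Taylor coefficients *)

Section SmoothNear.
Context {R : realType}.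
Variable a : R.
Implicit Types (f g : R -> R) (k n : nat).

Fixpoint derivable_near k f : Prop :=
  if k is k'.+1 then
    (\forall t \near a, derivable f t 1) /\ derivable_near k' (derive1 f)
  else True.

Definition smooth_near f : Prop := forall k, derivable_near k f.

Definition taylor_coef n f : R := derive1n n f a / n`!%:R.

Lemma is_derive_derive1 f (t : R) :
  derivable f t 1 -> is_derive t 1 f (derive1 f t).
Proof. by move=> dft; rewrite derive1E; exact/derivableP. Qed.

Lemma derive1_val f (t d : R) : is_derive t 1 f d -> derive1 f t = d.
Proof. by move=> dft; rewrite derive1E derive_val. Qed.

Lemma near_eq_derive1 f g : (\forall t \near a, f t = g t) ->
  \forall t \near a, derive1 f t = derive1 g t.
Proof.
move=> /near_join; apply: filterS => t fg.
by rewrite !derive1E; exact: near_eq_derive.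
Qed.

Lemma near_eq_derive1n n f g : (\forall t \near a, f t = g t) ->
  \forall t \near a, derive1n n f t = derive1n n g t.
Proof.
by move=> fg; elim: n => [//|n IH]; rewrite !derive1nS; exact: near_eq_derive1.
Qed.

Lemma near_eq_taylor_coef n f g : (\forall t \near a, f t = g t) ->
  taylor_coef n f = taylor_coef n g.
Proof.
by move=> /(near_eq_derive1n n)/nbhs_singleton fg; rewrite /taylor_coef fg.
Qed.

Lemma near_eq_derivable_near k f g : (\forall t \near a, f t = g t) ->
  derivable_near k f -> derivable_near k g.
Proof.
elim: k f g => [//|k IH] f g fg [df dkf]; split; last first.
  by apply: IH dkf; exact: near_eq_derive1.
apply: filterS2 df (near_join fg) => t dft fgt.
by apply: near_eq_derivable dft.
Qed.

Lemma derivable_nearW k f :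
  derivable_near k.+1 f -> derivable_near k f.
Proof. by elim: k f => [//|k IH] f [df /IH]. Qed.

Lemma derivable_nearS k f g :
  (\forall t \near a, is_derive (t : R) 1 f (g t)) ->
  derivable_near k g -> derivable_near k.+1 f.
Proof.
move=> dfg dg; split; first by apply: filterS dfg => t [].
apply: near_eq_derivable_near dg.
by apply: filterS dfg => t /derive1_val.
Qed.

Lemma derivable_nearD k f g : derivable_near k f ->
  derivable_near k g -> derivable_near k (fun t => f t + g t).
Proof.
elim: k f g => [//|k IH] f g [df dkf] [dg dkg].
apply: (derivable_nearS _ (IH _ _ dkf dkg)).
apply: filterS2 df dg => t /is_derive_derive1 dft /is_derive_derive1 dgt.
exact: is_deriveD.
Qed.

Lemma derivable_nearM k f g : derivable_near k f ->
  derivable_near k g -> derivable_near k (fun t => f t * g t).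
Proof.
elim: k f g => [//|k IH] f g dkf dkg.
have [[df dkf'] [dg dkg']] := (dkf, dkg).
apply: (@derivable_nearS _ _
  (fun t => f t * derive1 g t + derive1 f t * g t)).
  apply: filterS2 df dg => t /is_derive_derive1 dft /is_derive_derive1 dgt.
  apply: (is_derive_eq (is_deriveM dft dgt)).
  by rewrite [RHS]addrC /GRing.scale /= mulrC addrC [g t * _]mulrC.
by apply: derivable_nearD; apply: IH => //; exact: derivable_nearW.
Qed.

Lemma derivable_near_horner k (p : {poly R}) :
  derivable_near k (horner p).
Proof.
elim: k p => [//|k IH] p; split; last by rewrite -derivE.
by near=> t; exact: derivable_horner.
Unshelve. all: by end_near. Qed.

Lemma derivable_nearV k f : (\forall t \near a, f t != 0) ->
  derivable_near k f -> derivable_near k (fun t => (f t)^-1).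
Proof.
move=> f0; elim: k => [//|k IH] dkf; have [df dkf'] := dkf.
have dkV := IH (derivable_nearW dkf).
apply: (@derivable_nearS _ _
  (fun t => (- 1%:P).[t] * (((f t)^-1 * (f t)^-1) * derive1 f t))).
  apply: filterS2 f0 df => t f0t /is_derive_derive1 dft.
  apply: (is_derive_eq (is_deriveV f0t dft)).
  by rewrite hornerN hornerC /GRing.scale /= mulN1r mulNr expr2 invfM.
apply: derivable_nearM; first exact: derivable_near_horner.
by do 2! [apply: derivable_nearM => //].
Qed.

Lemma smooth_near_horner (p : {poly R}) : smooth_near (horner p).
Proof. by move=> k; exact: derivable_near_horner. Qed.

Lemma smooth_nearD f g : smooth_near f -> smooth_near g ->
  smooth_near (fun t => f t + g t).
Proof. by move=> sf sg k; exact: derivable_nearD. Qed.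

Lemma smooth_nearM f g : smooth_near f -> smooth_near g ->
  smooth_near (fun t => f t * g t).
Proof. by move=> sf sg k; exact: derivable_nearM. Qed.

Lemma smooth_nearV f : (\forall t \near a, f t != 0) -> smooth_near f ->
  smooth_near (fun t => (f t)^-1).
Proof. by move=> f0 sf k; exact: derivable_nearV. Qed.

Lemma smooth_near_cst c : smooth_near (fun=> c).
Proof.
rewrite (_ : (fun=> c) = horner c%:P); first exact: smooth_near_horner.
by apply/funext => t; rewrite hornerC.
Qed.

Lemma smooth_near_sum (I : Type) (s : seq I) (f : I -> R -> R) :
  (forall i, smooth_near (f i)) -> smooth_near (fun t => \sum_(i <- s) f i t).
Proof.
move=> sf; elim: s => [|i s IH].
  under [X in smooth_near X]funext do rewrite big_nil.
  exact: smooth_near_cst.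
under [X in smooth_near X]funext do rewrite big_cons.
exact: smooth_nearD.
Qed.

Lemma smooth_near_derivable f :
  smooth_near f -> \forall t \near a, derivable f t 1.
Proof. by move=> /(_ 1%N) []. Qed.

Lemma smooth_near_derive1 f : smooth_near f -> smooth_near (derive1 f).
Proof. by move=> sf k; have [] := sf k.+1. Qed.

Lemma smooth_near_primitive f g :
  (\forall t \near a, is_derive (t : R) 1 f (g t)) ->
  smooth_near g -> smooth_near f.
Proof.
move=> dfg sg k; apply: derivable_nearW.
exact: derivable_nearS dfg (sg k).
Qed.

Lemma taylor_coef0 f : taylor_coef 0 f = f a.
Proof. by rewrite /taylor_coef derive1n0 fact0 divr1. Qed.

Lemma taylor_coef_derive1 n f :
  taylor_coef n (derive1 f) = n.+1%:R * taylor_coef n.+1 f.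
Proof.
rewrite /taylor_coef derive1Sn factS natrM.
by field; rewrite nat1r !pnatr_eq0 -lt0n fact_gt0.
Qed.

Lemma taylor_coefS n f :
  taylor_coef n.+1 f = taylor_coef n (derive1 f) / n.+1%:R.
Proof. by rewrite taylor_coef_derive1 mulrC mulKf // pnatr_eq0. Qed.

Lemma taylor_coefD n f g : smooth_near f -> smooth_near g ->
  taylor_coef n (fun t => f t + g t) = taylor_coef n f + taylor_coef n g.
Proof.
elim: n f g => [|n IH] f g sf sg; first by rewrite !taylor_coef0.
rewrite !taylor_coefS -mulrDl -IH; [|exact: smooth_near_derive1..].
congr (_ / _); apply: near_eq_taylor_coef.
apply: filterS2 (smooth_near_derivable sf) (smooth_near_derivable sg) => t.
move=> /is_derive_derive1 dft /is_derive_derive1 dgt.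
exact: derive1_val (is_deriveD dft dgt).
Qed.

Lemma derive1n_horner n (p : {poly R}) : derive1n n (horner p) = horner p^`(n).
Proof. by elim: n => [//|n IH]; rewrite derive1nS IH -derivE derivnS. Qed.

Lemma taylor_coef_horner n (p : {poly R}) :
  taylor_coef n (horner p) = p^`N(n).[a].
Proof.
by rewrite /taylor_coef derive1n_horner nderivn_def hornerMn -mulr_natr mulfK.
Qed.

Lemma taylor_coef_cst n (c : R) : (0 < n)%N -> taylor_coef n (fun=> c) = 0.
Proof.
move=> n0; rewrite (_ : (fun=> c) = horner c%:P); last first.
  by apply/funext => t; rewrite hornerC.
by rewrite taylor_coef_horner nderivnC gtn_eqF // horner0.
Qed.

Lemma taylor_coefM n f g : smooth_near f -> smooth_near g ->
  taylor_coef n (fun t => f t * g t) =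
  \sum_(i < n.+1) taylor_coef i f * taylor_coef (n - i) g.
Proof.
elim: n f g => [|n IH] f g sf sg; first by rewrite big_ord1 !taylor_coef0.
have [sf' sg'] := (smooth_near_derive1 sf, smooth_near_derive1 sg).
have dfg : \forall t \near a, derive1 (fun t => f t * g t) t =
    derive1 f t * g t + f t * derive1 g t.
  apply: filterS2 (smooth_near_derivable sf) (smooth_near_derivable sg).
  move=> t /is_derive_derive1 dft /is_derive_derive1 dgt.
  rewrite (derive1_val (is_deriveM dft dgt)) /GRing.scale /= addrC.
  by rewrite [g t * _]mulrC.
rewrite taylor_coefS (near_eq_taylor_coef n dfg) taylor_coefD;
  [|exact: smooth_nearM..].
have n0 : n.+1%:R != 0 :> R by rewrite pnatr_eq0.
apply: (canLR (mulfK n0)).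
rewrite !IH // mulr_suml.
under eq_bigr do rewrite taylor_coef_derive1.
under [X in _ + X]eq_bigr do rewrite taylor_coef_derive1.
pose c i := taylor_coef i f * taylor_coef (n.+1 - i) g.
transitivity (\sum_(i < n.+2) i%:R * c i + \sum_(i < n.+2) (n.+1 - i)%:R * c i).
  rewrite [X in _ = X + _]big_ord_recl [X in _ = _ + X]big_ord_recr /= subnn.
  rewrite !mul0r add0r addr0; congr (_ + _); apply: eq_bigr => i _.
    by rewrite /c subSS mulrA.
  by rewrite mulrCA /c subSn // -ltnS.
rewrite -big_split; apply: eq_bigr => i _.
by rewrite /= -mulrDl -natrD subnKC 1?mulrC // -ltnS.
Qed.

Lemma taylor_coefZ n c f : smooth_near f ->
  taylor_coef n (fun t => c * f t) = c * taylor_coef n f.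
Proof.
move=> sf; elim: n f sf => [|n IH] f sf; first by rewrite !taylor_coef0.
rewrite !taylor_coefS mulrA -IH; last exact: smooth_near_derive1.
congr (_ / _); apply: near_eq_taylor_coef.
apply: filterS (smooth_near_derivable sf) => t.
by move=> /is_derive_derive1 dft; exact: derive1_val (is_deriveZ c dft).
Qed.

Lemma taylor_coef_sum n (I : Type) (s : seq I) (f : I -> R -> R) :
  (forall i, smooth_near (f i)) ->
  taylor_coef n (fun t => \sum_(i <- s) f i t) =
  \sum_(i <- s) taylor_coef n (f i).
Proof.
move=> sf; elim: s => [|i s IH].
  under [X in taylor_coef n X]funext do rewrite big_nil -(mul0r 0).
  by rewrite (taylor_coefZ n 0 (smooth_near_cst 0)) mul0r big_nil.
under [X in taylor_coef n X]funext do rewrite big_cons.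
by rewrite taylor_coefD ?big_cons ?IH //; exact: smooth_near_sum.
Qed.

End SmoothNear.

Lemma taylor_coef0_horner (R : realType) n (p : {poly R}) :
  taylor_coef 0 n (horner p) = p`_n.
Proof.
by rewrite taylor_coef_horner horner_coef0 coef_nderivn addn0 binn mulr1n.
Qed.

(** * Generating functions *)

Section QuadraticPoly.
Context {R : realType}.
Implicit Types (x t : R) (c d : nat -> R).

Definition quadratic_poly x : {poly R} := 1 - (2 * x) *: 'X + 'X ^+ 2.

Lemma horner_quadratic_poly x t :
  (quadratic_poly x).[t] = 1 - 2 * x * t + t ^+ 2.
Proof. by rewrite /quadratic_poly !hornerE. Qed.

Lemma quadratic_poly_near0 x : \forall t \near 0, 0 < (quadratic_poly x).[t].
Proof.
have /cvgr_gt := @continuous_horner R (quadratic_poly x) 0; apply.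
by rewrite horner_quadratic_poly mulr0 expr0n subr0 addr0.
Qed.

(* The power series [c] is [1 - 2 x t + t ^+ 2] times the power series [d]. *)
Definition quadratic_multiple x d c : Prop :=
  [/\ c 0%N = d 0%N, c 1%N = d 1%N - 2 * x * d 0%N
    & forall n, c n.+2 = d n.+2 - 2 * x * d n.+1 + d n].

Lemma quadratic_multiple_inj x d d' c :
  quadratic_multiple x d c -> quadratic_multiple x d' c -> d =1 d'.
Proof.
move=> [c0 c1 cSS] [c0' c1' cSS']; have d0 : d 0%N = d' 0%N by rewrite -c0.
elim/nat_ind2 => // [|n dn dSn].
  by apply: (addIr (- (2 * x * d' 0%N))); rewrite -c1' c1 d0.
apply: (addIr (- (2 * x * d' n.+1) + d' n)).
by rewrite !addrA -cSS' cSS dn dSn.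
Qed.

Lemma taylor_coef_quadratic_multiple x f : smooth_near 0 f ->
  quadratic_multiple x (taylor_coef 0 ^~ f)
    (taylor_coef 0 ^~ (fun t => (quadratic_poly x).[t] * f t)).
Proof.
move=> sf.
have coefM n := taylor_coefM n (smooth_near_horner 0 (quadratic_poly x)) sf.
have qE i : taylor_coef 0 i (horner (quadratic_poly x)) =
    [:: 1; - (2 * x); 1]`_i.
  rewrite taylor_coef0_horner coefD coefB coef1 coefZ coefX coefXn.
  by case: i => [|[|[|i]]] /=; rewrite ?nth_nil; ring.
split=> [||n]; rewrite coefM.
- by rewrite big_ord1 qE mul1r.
- by rewrite big_ord_recl big_ord1 !qE /= mul1r mulNr.
rewrite !big_ord_recl big1 => [|i _]; last by rewrite qE /= nth_nil mul0r.
by rewrite !qE /= !subSS !subn0 !mul1r mulNr addr0 addrA.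
Qed.

End QuadraticPoly.

Section GegenbauerRecurrence.
Context {R : realType}.
Implicit Types (x : R).

Lemma smooth_near_quadraticV lam x :
  smooth_near 0 (fun t => (1 - 2 * x * t + t ^+ 2) ^- lam).
Proof.
apply: smooth_nearV.
  apply: filterS (quadratic_poly_near0 x) => t.
  by rewrite horner_quadratic_poly => q0; rewrite expf_neq0 // gt_eqF.
under [X in smooth_near _ X]funext do
  rewrite -horner_quadratic_poly -horner_exp.
exact: smooth_near_horner.
Qed.

Lemma gegenbauer_quadratic_multiple lam x :
  quadratic_multiple x (gegenbauer lam.+1 ^~ x) (gegenbauer lam ^~ x).
Proof.
have sm := smooth_near_quadraticV lam.+1 x.
have [c0 c1 cSS] := taylor_coef_quadratic_multiple x sm.
have cE n : gegenbauer lam n x = taylor_coef 0 n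
    (fun t => (quadratic_poly x).[t] * (1 - 2 * x * t + t ^+ 2) ^- lam.+1).
  apply: near_eq_taylor_coef; apply: filterS (quadratic_poly_near0 x) => t.
  rewrite horner_quadratic_poly => q0.
  by rewrite [_ ^+ lam.+1]exprS invfM mulVKf // gt_eqF.
by split=> [||n]; rewrite !cE ?c0 ?c1 ?cSS.
Qed.

Lemma gegenbauer0E n x : gegenbauer 0 n x = (n == 0)%:R.
Proof.
rewrite (_ : gegenbauer 0 n x = taylor_coef 0 n (horner 1)).
  by rewrite taylor_coef0_horner coef1.
by congr taylor_coef; apply/funext => t; rewrite hornerC expr0 invr1.
Qed.

End GegenbauerRecurrence.

(** * Gegenbauer polynomials and their zeros *)

Lemma pochhammerS (R : pzRingType) (a : R) k :
  pochhammer a k.+1 = pochhammer a k * (a + k%:R).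
Proof. by rewrite /pochhammer big_ord_recr. Qed.

Lemma pochhammerSl (R : pzRingType) (a : R) k :
  pochhammer a k.+1 = a * pochhammer (a + 1) k.
Proof.
rewrite /pochhammer big_ord_recl addr0; congr (_ * _).
by apply: eq_bigr => i _; rewrite -addrA nat1r.
Qed.

Lemma pochhammer_nat (R : pzRingType) n k :
  pochhammer (n.+1%:R : R) k = ((n + k) ^_ k)%:R.
Proof.
elim: k n => [|k IH] n; first by rewrite /pochhammer big_ord0 ffactn0.
by rewrite pochhammerSl natr1 IH -natrM mulnC addSnnS ffactnSr -addSnnS addnK.
Qed.

Lemma pochhammer_natV_fact (R : numFieldType) n k :
  pochhammer (n.+1%:R : R) k / k`!%:R = 'C(n + k, k)%:R.
Proof.
by rewrite pochhammer_nat -bin_ffact natrM mulfK // pnatr_eq0 -lt0n fact_gt0.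
Qed.

Section GegenbauerPoly.
Context {R : realType}.
Implicit Types (l n : nat).

Definition gegenbauer_poly l n : {poly R} :=
  2 ^- l *: (chebyshevU R (n + l).+1)^`N(l).

Lemma coef_gegenbauer_poly_top l n :
  (gegenbauer_poly l n)`_n = 2 ^+ n * 'C(l + n, n)%:R.
Proof.
rewrite coefZ coef_nderivn [(l + n)%N]addnC coef_chebyshevU.
rewrite !mulrnAr mulr1 exprD [2 ^+ n * _]mulrC mulKf ?expf_neq0 //.
by rewrite -[in RHS]bin_sub ?leq_addr // addKn.
Qed.

Lemma size_gegenbauer_poly l n : size (gegenbauer_poly l n) = n.+1.
Proof.
apply/eqP; rewrite eqn_leq; apply/andP; split.
  apply/leq_sizeP => k nk.
  rewrite coefZ coef_nderivn nth_default ?mul0rn ?mulr0 //.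
  by rewrite (leq_trans (size_chebyshevU_leq _ _)) // addnC ltn_add2l.
rewrite ltnNge; apply/negP => /leq_sizeP/(_ n (leqnn n))/eqP.
rewrite coef_gegenbauer_poly_top mulf_eq0 expf_eq0 !pnatr_eq0 andbF /=.
by rewrite eqn0Ngt bin_gt0 leq_addl.
Qed.

Lemma deriv_gegenbauer_poly l n :
  (gegenbauer_poly l n.+1)^`() = (2 * l.+1%:R) *: gegenbauer_poly l.+1 n.
Proof.
rewrite derivZ deriv_nderivn -[_ *+ l.+1]scaler_nat !scalerA addSnnS.
by congr (_ *: _); rewrite exprS; field; rewrite expf_neq0.
Qed.

Lemma gegenbauer_poly_quadratic_multiple l x :
  quadratic_multiple x (fun n => (gegenbauer_poly l.+1 n).[x])
    (fun n => (gegenbauer_poly l n).[x]).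
Proof.
have vanish n k : (n <= k)%N -> ((chebyshevU R n)^`N(k)).[x] = 0.
  move=> nk; rewrite nderivn_poly0 ?horner0 //.
  exact: leq_trans (size_chebyshevU_leq _ _) nk.
have rec n : (gegenbauer_poly l n).[x] = 2 ^- l.+1 *
    (((chebyshevU R (n + l).+2)^`N(l.+1)).[x]
     - 2 * x * ((chebyshevU R (n + l).+1)^`N(l.+1)).[x]
     + ((chebyshevU R (n + l))^`N(l.+1)).[x]).
  rewrite nderivn_chebyshevU !(hornerD, hornerN, hornerZ, hornerM, hornerX).
  by rewrite exprS invfM; field; rewrite expf_neq0.
split=> [||n]; rewrite rec /gegenbauer_poly !hornerZ.
- by rewrite !add0n (vanish l.+1) // (vanish l) //; ring.
- by rewrite !add1n (vanish l.+1) // add0n; ring.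
- by rewrite !addSn !addnS; ring.
Qed.

Lemma gegenbauer_poly0_quadratic_multiple x :
  quadratic_multiple x (fun n => (gegenbauer_poly 0 n).[x]) (gegenbauer 0 ^~ x).
Proof.
split=> [||n]; rewrite gegenbauer0E /gegenbauer_poly expr0 invr1 !scale1r.
all: rewrite !nderivn0 !addn0 ?chebyshevUSS.
all: rewrite !(hornerD, hornerN, hornerZ, hornerM, hornerX, hornerC) /=.
all: rewrite ?horner0.
all: by ring.
Qed.

Lemma horner_gegenbauer_poly l n x :
  (gegenbauer_poly l n).[x] = gegenbauer l.+1 n x.
Proof.
elim: l n => [|l IH];
  apply: quadratic_multiple_inj (gegenbauer_quadratic_multiple _ x).
  exact: gegenbauer_poly0_quadratic_multiple.
have [c0 c1 cSS] := gegenbauer_poly_quadratic_multiple l x.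
by split=> *; rewrite -!IH.
Qed.

End GegenbauerPoly.

Section GegenbauerZeros.
Context {R : realType}.
Implicit Types (l n k : nat).

Lemma sin_natpi k : sin (k%:R * pi) = 0 :> R.
Proof.
by rewrite mulr_natl -[_ *+ k]add0r (alternatingn (@sinDpi R)) sin0 mulr0.
Qed.

Lemma cos_natpi k : cos (k%:R * pi) = (-1) ^+ k :> R.
Proof.
by rewrite mulr_natl -[_ *+ k]add0r (alternatingn (@cosDpi R)) cos0 mulr1.
Qed.

Lemma chebyshevU_roots n : exists s : seq R,
  [/\ size s = n, sorted <%R s, all (root (chebyshevU R n.+1)) s
    & all (mem `]-1, 1[) s].
Proof.
pose angle k : R := k.+1%:R * pi / n.+1%:R.
have angle_itv k : (k < n)%N -> 0 < angle k < pi.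
  move=> kn; rewrite divr_gt0 ?mulr_gt0 ?ltr0n ?pi_gt0 //=.
  by rewrite ltr_pdivrMr ?ltr0n // mulrC ltr_pM2l ?pi_gt0 // ltr_nat.
have angle_itvcc k : (k < n)%N -> angle k \in `[0, pi].
  by move=> /angle_itv/andP[? ?]; rewrite in_itv /= !ltW.
exists (sort <=%R [seq cos (angle k) | k <- iota 0 n]).
rewrite size_sort size_map size_iota sort_lt_sorted !all_sort; split=> //.
- rewrite map_inj_in_uniq ?iota_uniq // => i j; rewrite !mem_iota /= => ni nj.
  move=> /(cos_inj (angle_itvcc _ ni) (angle_itvcc _ nj)).
  move=> /(mulIf (invr_neq0 _))/(mulIf (lt0r_neq0 (pi_gt0 R)))/eqP.
  by rewrite pnatr_eq0 eqr_nat => /(_ isT)/eqP[].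
- apply/allP => _ /mapP[k + ->]; rewrite mem_iota /= => kn.
  have sin_neq0 : sin (angle k) != 0.
    by rewrite gt_eqF // sin_gt0_pi // angle_itv.
  apply/rootP/(mulfI sin_neq0).
  by rewrite sin_chebyshevU mulr0 mulrC divfK ?pnatr_eq0 // sin_natpi.
- apply/allP => _ /mapP[k + ->]; rewrite mem_iota /= => kn.
  have /andP[angle_gt0 angle_ltpi] := angle_itv k kn; rewrite /= in_itv /=.
  rewrite -cospi -(@cos0 R) !ltr_cos ?angle_itvcc ?in_itv /= ?lexx ?pi_ge0 //.
  by rewrite angle_gt0 angle_ltpi.
Qed.

Definition gegenbauer_angles l n (s : seq R) : Prop :=
  [/\ size s = n, {in s, forall phi, 0 < phi < pi}
    & forall x, gegenbauer l.+1 n x =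
        2 ^+ n * (pochhammer l.+1%:R n / n`!%:R)
        * \prod_(phi <- s) (x - cos phi)].

Lemma gegenbauer_angles_exist l n : exists s, gegenbauer_angles l n s.
Proof.
have [t [st t_sorted t_root t_itv]] := chebyshevU_roots (n + l).
have [s [ss s_sorted s_root s_itv]] := derivn_roots l t_sorted t_root t_itv.
have {}ss : size s = n by rewrite ss st addnK.
have acos_itv y : y \in s -> 0 < acos y < pi /\ cos (acos y) = y.
  move=> /(allP s_itv) /=; rewrite in_itv /= => /andP[y_gtN1 y_lt1].
  split; last by rewrite acosK // in_itv /= !ltW.
  by rewrite acos_gt0 ?acos_ltpi ?y_gtN1 ?y_lt1 ?ltW.
exists [seq acos y | y <- s]; split => [|_ /mapP[y /acos_itv[? _] ->]//|x].
  by rewrite size_map.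
have gegenbauer_root : all (root (gegenbauer_poly l n)) s.
  apply: sub_all s_root => y; rewrite /root nderivn_def hornerMn hornerZ.
  rewrite -mulr_natr mulf_eq0 pnatr_eq0 eqn0Ngt fact_gt0 orbF => /eqP ->.
  by rewrite mulr0.
rewrite -horner_gegenbauer_poly (all_roots_prod_XsubC _ gegenbauer_root).
- rewrite hornerZ lead_coefE size_gegenbauer_poly coef_gegenbauer_poly_top.
  rewrite pochhammer_natV_fact horner_prod big_map; congr (_ * _).
  by apply: eq_big_seq => y /acos_itv[_ ->]; rewrite hornerXsubC.
- by rewrite size_gegenbauer_poly ss.
- by rewrite uniq_rootsE lt_sorted_uniq.
Qed.

Lemma gegenbauer_lead_gt0 l n : 0 < pochhammer (l.+1%:R : R) n / n`!%:R.
Proof. by rewrite pochhammer_natV_fact ltr0n bin_gt0 leq_addl. Qed.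

End GegenbauerZeros.

(** * The finite sine expansion *)

(* The substitution [x = (z + z^-1) / 2] turns differentiation of [p] into
   this operator on [(z ^+ 2 - 1) ^+ m * z ^+ n * p.[x]], up to a factor; see
   [horner_joukowski_deriv]. *)
Section JoukowskiOperator.
Context {R : comNzRingType}.
Variables m n : nat.
Implicit Types p q : {poly R}.

Definition joukowski_op p : {poly R} :=
  ('X ^+ 2 - 1) * ('X * p^`() - n%:R *: p) - (2 * m)%:R *: ('X ^+ 2 * p).

Fact joukowski_op_is_linear : linear joukowski_op.
Proof.
move=> k p q; rewrite /joukowski_op derivD derivZ !mulrDr -!scalerAr.
by rewrite -!mul_polyC !mulrDr; ring.
Qed.

HB.instance Definition _ := GRing.isLinear.Build R {poly R} {poly R} _
  joukowski_op joukowski_op_is_linear.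

Lemma joukowski_opXn k : joukowski_op 'X^k =
  (k%:R - n%:R - (2 * m)%:R) *: 'X^(k + 2) - (k%:R - n%:R) *: 'X^k.
Proof.
rewrite /joukowski_op (_ : 'X * _ = k%:R *: 'X^k); last first.
  case: k => [|k]; first by rewrite derivXn mulr0n mulr0 scale0r.
  by rewrite derivXn mulrnAr -exprS scaler_nat.
by rewrite -scalerBl exprD -!mul_polyC !polyCB; ring.
Qed.

End JoukowskiOperator.

Section JoukowskiDerivative.
Context {R : realType}.
Implicit Types (p q : {poly R}) (z : R).

Lemma is_derive_horner_joukowski p z : z != 0 ->
  is_derive z 1 (fun w => p.[(w + w^-1) / 2])
    (p^`().[(z + z^-1) / 2] * (1 - z ^- 2) / 2).
Proof.
move=> z0; have dJ : is_derive z 1 (fun w : R => 2^-1 * (w + w^-1))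
    (2^-1 * (1 + - z ^- 2 * 1)).
  apply: is_deriveZ; apply: is_deriveD.
  exact: (is_deriveV z0 (is_derive_id z 1)).
rewrite (_ : (fun w => _) = horner p \o (fun w => 2^-1 * (w + w^-1))).
  have dpJ := @is_derive1_comp _ (horner p) _ z _ _ (is_derive_poly p _) dJ.
  by apply: is_derive_eq; rewrite [2^-1 * (z + _)]mulrC mulr1; ring.
by apply/funext => w /=; rewrite mulrC.
Qed.

Lemma horner_joukowski_deriv p q m n :
  (forall z, z != 0 ->
     (z ^+ 2 - 1) ^+ m * z ^+ n.+1 * p.[(z + z^-1) / 2] = q.[z]) ->
  forall z, z != 0 ->
    (z ^+ 2 - 1) ^+ m.+2 * z ^+ n * p^`().[(z + z^-1) / 2] =
    2 * (joukowski_op m n.+1 q).[z].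
Proof.
move=> pq z z0.
pose w : {poly R} := ('X ^+ 2 - 1) ^+ m * 'X ^+ n.+1.
have wE y : w.[y] = (y ^+ 2 - 1) ^+ m * y ^+ n.+1.
  by rewrite hornerM !horner_exp hornerD hornerN hornerC hornerXn hornerX.
have dwE : z * (z ^+ 2 - 1) * w^`().[z] =
    ((2 * m)%:R * z ^+ 2 + n.+1%:R * (z ^+ 2 - 1)) * w.[z].
  rewrite wE derivM deriv_exp derivB derivXn derivC subr0 derivXn.
  rewrite !(hornerD, hornerN, hornerM, hornerMn, horner_exp, hornerXn, hornerC).
  rewrite hornerX; case: m {pq w wE} => [|m] /=; rewrite [z ^+ n.+1]exprS.
    by ring.
  by rewrite [(z ^+ 2 - 1) ^+ m.+1]exprS; ring.
have dqE : q^`().[z] = w^`().[z] * p.[(z + z^-1) / 2]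
    + w.[z] * (p^`().[(z + z^-1) / 2] * (1 - z ^- 2) / 2).
  have dwp := is_deriveM (is_derive_poly w z) (is_derive_horner_joukowski p z0).
  have wp_near : \forall y \near z, w.[y] * p.[(y + y^-1) / 2] = q.[y].
    by apply: filterS (cvgr_neq0 z cvg_id z0) => y y0; rewrite wE pq.
  have dq : is_derive z 1 (horner q) _ := near_eq_is_derive wp_near dwp.
  rewrite [horner q^`()]derivE (derive1_val dq) /GRing.scale /= addrC.
  by rewrite [_ * w^`().[z]]mulrC.
rewrite /joukowski_op.
rewrite !(hornerD, hornerN, hornerM, hornerZ, hornerXn, hornerX, hornerC).
rewrite dqE -pq // -wE.
move: p.[_] p^`().[_] w^`().[z] dwE => px dpx dw dwE.
transitivity (2 * (z * (z ^+ 2 - 1) * dw * px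
  + (z ^+ 2 - 1) * z * w.[z] * (dpx * (1 - z ^- 2) / 2)
  - ((2 * m)%:R * z ^+ 2 + n.+1%:R * (z ^+ 2 - 1)) * w.[z] * px)); last by ring.
by rewrite dwE wE !exprS; field.
Qed.

End JoukowskiDerivative.

Section FiniteSineExpansion.
Context {R : realType}.
Implicit Types (lam l nu n : nat) (z : R).

Lemma alpha0 lam n : alpha lam 0 n = 1 :> R.
Proof. by rewrite /alpha /pochhammer !big_ord0 fact0 !mulr1 divr1. Qed.

Lemma alpha_diag lam n : alpha lam.+1 lam.+1 n = 0 :> R.
Proof.
rewrite /alpha pochhammerS (_ : 1 - _ + _ = 0) ?mulr0 ?mul0r //.
by rewrite -natr1; ring.
Qed.

Lemma alphaS lam nu n :
  (n%:R + 3 - 2 * lam%:R + 2 * nu%:R) * alpha lam nu n.+1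
  - (n%:R + 3 + 2 * lam%:R + 2 * nu%:R) * alpha lam nu.+1 n.+1
  = - (n%:R + 1 + 2 * lam%:R) * alpha lam.+1 nu.+1 n :> R.
Proof.
have pn_neq0 k j : pochhammer (k.+1%:R : R) j != 0.
  by rewrite pochhammer_nat pnatr_eq0 -lt0n ffact_gt0 leq_addl.
have D_neq0 := pn_neq0 (n + lam).+1 nu.
have nu1_neq0 : nu%:R + 1 != 0 :> R by rewrite natr1 pnatr_eq0.
have last_neq0 : n%:R + lam%:R + 2 + nu%:R != 0 :> R.
  by rewrite -!natrD pnatr_eq0 addnAC addn2.
have fact_neq0 : nu`!%:R != 0 :> R by rewrite pnatr_eq0 -lt0n fact_gt0.
have lamS : 1 - lam.+1%:R + 1 = 1 - lam%:R :> R by rewrite -natr1; ring.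
rewrite /alpha addnS addSn !factS !natrM !(pochhammerS (_ - lam%:R)).
rewrite !(pochhammerS (n.+2%:R)) !(pochhammerS ((n + lam).+2%:R)).
rewrite !(pochhammerSl (_ - lam.+1%:R)) lamS (pochhammerSl n.+1%:R).
rewrite [n.+1%:R + 1]natr1 -[nu.+1%:R]natr1 -[lam.+1%:R]natr1.
move: (pochhammer (n + lam).+2%:R nu) D_neq0 => D D_neq0.
have -> : (n + lam).+2%:R = n%:R + lam%:R + 2 :> R by rewrite -addn2 !natrD.
by field; rewrite D_neq0 last_neq0 fact_neq0 nu1_neq0.
Qed.

Definition pz_term lam n nu : {poly R} :=
  'X^(2 * n + 2 * lam + 2 * nu) - 'X^(2 * lam - 2 * nu - 2).

Definition pz_poly lam n : {poly R} :=
  \sum_(nu < lam) alpha lam nu n *: pz_term lam n nu.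

Lemma horner_pz_poly lam n z : (pz_poly lam n).[z] = pz lam n z.
Proof.
rewrite horner_sum; apply: eq_bigr => nu _.
by rewrite hornerZ hornerD hornerN !hornerXn.
Qed.

Lemma joukowski_op_pz_term l n nu : (nu <= l)%N ->
  joukowski_op (2 * l).+1 n.+1 (pz_term l.+1 n.+1 nu) =
  (n%:R + 3 - 2 * l.+1%:R + 2 * nu%:R) *: pz_term l.+2 n nu.+1
  - (n%:R + 1 + 2 * l.+1%:R + 2 * nu%:R) *: pz_term l.+2 n nu.
Proof.
move=> nu_le; rewrite -(subnK nu_le) /pz_term; move: (l - nu)%N => k.
set top := (2 * n.+1 + 2 * (k + nu).+1 + 2 * nu)%N.
have -> : (2 * n + 2 * (k + nu).+2 + 2 * nu.+1 = top + 2)%N by lia.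
have -> : (2 * n + 2 * (k + nu).+2 + 2 * nu = top)%N by lia.
have -> : (2 * (k + nu).+2 - 2 * nu - 2 = 2 * k + 2)%N by lia.
have -> : (2 * (k + nu).+2 - 2 * nu.+1 - 2 = 2 * k)%N by lia.
have -> : (2 * (k + nu).+1 - 2 * nu - 2 = 2 * k)%N by lia.
rewrite linearB /= !joukowski_opXn.
have -> : top%:R = 2 * n.+1%:R + 2 * (k + nu).+1%:R + 2 * nu%:R :> R.
  by rewrite /top; ring.
move: ('X^_) ('X^_) ('X^_) ('X^_) => x1 x2 x3 x4.
rewrite !natrM -![_.+1%:R]natr1 natrM natrD.
rewrite -!mul_polyC !(polyCB, polyCD, polyCM, polyC1).
by ring.
Qed.

Lemma joukowski_op_pz_poly l n :
  joukowski_op (2 * l).+1 n.+1 (pz_poly l.+1 n.+1) =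
  - (n%:R + 1 + 2 * l.+1%:R) *: pz_poly l.+2 n.
Proof.
pose kept nu : R := n%:R + 1 + 2 * l.+1%:R + 2 * nu%:R.
pose kept_term nu := (alpha l.+1 nu n.+1 * kept nu) *: pz_term l.+2 n nu.
have kept_sum :
    \sum_(nu < l.+1) kept_term nu = \sum_(nu < l.+2) kept_term nu.
  by rewrite [RHS]big_ord_recr /= /kept_term alpha_diag mul0r scale0r addr0.
rewrite linear_sum /=.
under eq_bigr => nu _.
  rewrite linearZ /= joukowski_op_pz_term -1?ltnS // scalerBr !scalerA.
  over.
rewrite sumrB kept_sum [X in _ - X]big_ord_recl opprD addrCA -sumrB.
rewrite /kept_term scaler_sumr [RHS]big_ord_recl !alpha0; congr (_ + _).
  by rewrite -scaleNr scalerA /kept /=; congr (_ *: _); ring.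
apply: eq_bigr => nu _; rewrite -scalerBl scalerA -alphaS /kept.
by congr (_ *: _); rewrite /= -[bump 0 nu]/(nu.+1) -!natr1; ring.
Qed.

(* At [z = e^(i t)] this is the expansion of
   [sin t ^ (2 l + 1) C_n^(l+1) (cos t)] in sines of multiples of [t]. *)
Lemma gegenbauer_pz l n : exists2 c : R, c != 0 & forall z, z != 0 ->
  (z ^+ 2 - 1) ^+ (2 * l).+1 * z ^+ n * gegenbauer l.+1 n ((z + z^-1) / 2) =
  c * pz l.+1 n z.
Proof.
elim: l n => [|l IH] n.
  exists 1; first exact: oner_neq0.
  move=> z z0; rewrite muln0 expr1 mul1r -horner_gegenbauer_poly.
  rewrite /gegenbauer_poly nderivn0 addn0 expr0 invr1 scale1r.
  rewrite /pz big_ord1 alpha0 mul1r /= muln0 addn0 muln1 subnn expr0.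
  transitivity
    (z ^+ n.+1 * ((z - z^-1) * (chebyshevU R n.+1).[(z + z^-1) / 2])).
    by rewrite [z ^+ n.+1]exprS; field.
  rewrite chebyshevU_joukowski // mulrBr divff ?expf_neq0 // -exprD.
  by congr (z ^+ _ - 1); lia.
have [c c0 cE] := IH n.+1.
have l_neq0 : l.+1%:R != 0 :> R by rewrite pnatr_eq0.
pose k : R := n%:R + 1 + 2 * l.+1%:R.
have k_neq0 : k != 0.
  suff -> : k = (n + 2 * l.+1).+1%:R by rewrite pnatr_eq0.
  by rewrite -natr1 natrD natrM /k; ring.
exists (- (k / l.+1%:R * c)) => [|z z0].
  by rewrite oppr_eq0 !mulf_neq0 ?invr_eq0.
have cpE w : w != 0 -> (w ^+ 2 - 1) ^+ (2 * l).+1 * w ^+ n.+1 *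
    (gegenbauer_poly l n.+1).[(w + w^-1) / 2] = (c *: pz_poly l.+1 n.+1).[w].
  by move=> w0; rewrite horner_gegenbauer_poly cE // hornerZ horner_pz_poly.
apply: (mulfI (mulf_neq0 (_ : 2 != 0) l_neq0)) => //.
rewrite mulrCA (_ : (2 * l.+1).+1 = (2 * l).+3)%N; last by lia.
rewrite -horner_gegenbauer_poly -hornerZ -deriv_gegenbauer_poly.
rewrite (horner_joukowski_deriv cpE z0) linearZ /= joukowski_op_pz_poly.
by rewrite !hornerZ horner_pz_poly /k; field.
Qed.

End FiniteSineExpansion.

(** * Taylor coefficients of ln |p| *)

Lemma ln_prod (R : realType) (I : eqType) (s : seq I) (F : I -> R) :
  {in s, forall i, 0 < F i} -> ln (\prod_(i <- s) F i) = \sum_(i <- s) ln (F i).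
Proof.
elim: s => [|i s IH] F0; first by rewrite !big_nil ln1.
have F0s : {in s, forall j, 0 < F j} by move=> j js; rewrite F0 // inE js orbT.
rewrite !big_cons lnM ?IH // posrE ?F0 ?mem_head //.
by rewrite big_seq; apply: prodr_gt0 => j /F0s.
Qed.

Section LogTaylor.
Context {R : realType}.
Implicit Types (phi z : R) (s : seq R) (l n k : nat).

Definition log_quadratic phi z : R := ln (quadratic_poly (cos phi)).[z].

Let dlog_quadratic phi z : R :=
  (quadratic_poly (cos phi))^`().[z] * (quadratic_poly (cos phi)).[z]^-1.

Lemma is_derive_log_quadratic phi : \forall z \near 0,
  is_derive (z : R) 1 (log_quadratic phi) (dlog_quadratic phi z).
Proof.
apply: filterS (quadratic_poly_near0 (cos phi)) => z q_gt0.
have dln := @is_derive1_comp _ (@ln R) _ z _ _ (is_derive1_ln q_gt0)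
  (is_derive_poly _ z).
by apply: is_derive_eq; rewrite mulrC.
Qed.

Lemma smooth_near_dlog_quadratic phi : smooth_near 0 (dlog_quadratic phi).
Proof.
apply: smooth_nearM; first exact: smooth_near_horner.
apply: smooth_nearV; last exact: smooth_near_horner.
by apply: filterS (quadratic_poly_near0 (cos phi)) => z; exact: lt0r_neq0.
Qed.

Lemma smooth_near_log_quadratic phi : smooth_near 0 (log_quadratic phi).
Proof.
exact: smooth_near_primitive (is_derive_log_quadratic phi)
  (smooth_near_dlog_quadratic phi).
Qed.

Lemma deriv_quadratic_poly (x : R) :
  (quadratic_poly x)^`() = 2 *: 'X - (2 * x)%:P.
Proof.
rewrite /quadratic_poly derivD derivB derivC derivZ derivX derivXn sub0r addrC.
by rewrite expr1 alg_polyC scaler_nat.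
Qed.

Lemma taylor_coef_dlog_quadratic n phi :
  taylor_coef 0 n (dlog_quadratic phi) = - (2 * cos (n.+1%:R * phi)).
Proof.
pose dq := (quadratic_poly (cos phi))^`().
apply: (@quadratic_multiple_inj _ (cos phi)
  (taylor_coef 0 ^~ (dlog_quadratic phi)) (fun k => - (2 * cos (k.+1%:R * phi)))
  (taylor_coef 0 ^~ (horner dq))).
  have [c0 c1 cSS] := taylor_coef_quadratic_multiple (cos phi)
                        (smooth_near_dlog_quadratic phi).
  have dqE k : taylor_coef 0 k (horner dq) = taylor_coef 0 k
      (fun t => (quadratic_poly (cos phi)).[t] * dlog_quadratic phi t).
    apply: near_eq_taylor_coef; apply: filterS (quadratic_poly_near0 (cos phi)).
    by move=> t q_gt0; rewrite /dlog_quadratic mulrCA divff ?mulr1 // gt_eqF.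
  by split=> [||k]; rewrite dqE ?c0 ?c1 ?cSS.
split=> [||k]; rewrite taylor_coef0_horner /dq deriv_quadratic_poly.
all: rewrite coefB coefZ coefX coefC /=.
- by rewrite mul1r mulr0 sub0r.
- by rewrite mul1r [2%:R * phi]mulr_natl cos_mulr2n -mulr_natl; ring.
have -> : k.+3%:R * phi = k.+2%:R * phi + phi by rewrite -[k.+3%:R]natr1; ring.
have -> : k.+1%:R * phi = k.+2%:R * phi - phi by rewrite -[k.+2%:R]natr1; ring.
by rewrite cosB cosD; ring.
Qed.

Lemma taylor_coef_log_quadratic k phi : (0 < k)%N ->
  taylor_coef 0 k (log_quadratic phi) = - (2 * cos (k%:R * phi)) / k%:R.
Proof.
case: k => // k _; rewrite taylor_coefS -taylor_coef_dlog_quadratic.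
congr (_ / _); apply: near_eq_taylor_coef.
by apply: filterS (is_derive_log_quadratic phi) => z /derive1_val.
Qed.

Lemma pz_factor l n s : gegenbauer_angles l n s -> exists2 c : R, c != 0 &
  forall z, pz l.+1 n z =
    c * (z ^+ 2 - 1) ^+ (2 * l).+1
    * \prod_(phi <- s) (quadratic_poly (cos phi)).[z].
Proof.
move=> [ss _ sE]; have [c c0 cE] := @gegenbauer_pz R l n.
set b := pochhammer _ _ / _ in sE.
have b0 : b != 0 by rewrite gt_eqF // gegenbauer_lead_gt0.
exists (b / c) => [|z]; first by rewrite mulf_neq0 ?invr_eq0.
pose q : {poly R} := (b / c) *: (('X ^+ 2 - 1) ^+ (2 * l).+1
  * \prod_(phi <- s) quadratic_poly (cos phi)).
have qE w : q.[w] = b / c * (w ^+ 2 - 1) ^+ (2 * l).+1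
    * \prod_(phi <- s) (quadratic_poly (cos phi)).[w].
  rewrite hornerZ hornerM horner_exp horner_prod hornerD hornerN hornerXn.
  by rewrite hornerC mulrA.
rewrite -horner_pz_poly -qE; congr _.[z]; apply: (@poly_eq_off _ 0) => w w0.
rewrite horner_pz_poly qE; apply: (mulfI c0); rewrite -cE // sE.
have -> : \prod_(phi <- s) (quadratic_poly (cos phi)).[w] =
    2 ^+ n * w ^+ n * \prod_(phi <- s) ((w + w^-1) / 2 - cos phi).
  rewrite -exprMn -ss -[size s]count_predT -iter_mulr_1 -big_const_seq.
  rewrite -big_split; apply: eq_bigr => phi _.
  by rewrite horner_quadratic_poly /=; field.
by field.
Qed.

Lemma quadratic_poly_cos_gt0 phi z : -1 < z < 1 ->
  0 < (quadratic_poly (cos phi)).[z].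
Proof.
move=> /andP[z_gtN1 z_lt1]; rewrite horner_quadratic_poly.
have [c_geN1 c_le1] := (cos_geN1 phi, cos_le1 phi).
have [z_ge0|z_lt0] := leP 0 z; nra.
Qed.

Lemma ln_pz_near0 l n s : gegenbauer_angles l n s -> exists c : R,
  \forall z \near 0, ln `|pz l.+1 n z| =
    c + ((2 * l).+1%:R / 2 * (log_quadratic 0 z + log_quadratic pi z)
         + \sum_(phi <- s) log_quadratic phi z).
Proof.
move=> /pz_factor[c c0 pzE]; exists (ln `|c|).
have z_near : \forall z \near (0 : R), z \in `]-1, 1[.
  by apply: near_in_itvoo; rewrite in_itv /= ltrN10 ltr01.
apply: filterS z_near => z; rewrite in_itv /= => z1.
have q_gt0 phi : 0 < (quadratic_poly (cos phi)).[z].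
  exact: quadratic_poly_cos_gt0.
have prod_gt0 : 0 < \prod_(phi <- s) (quadratic_poly (cos phi)).[z].
  exact: prodr_gt0.
have ends : `|z ^+ 2 - 1| ^+ 2 =
    (quadratic_poly (cos 0)).[z] * (quadratic_poly (cos pi)).[z].
  by rewrite real_normK ?num_real // cos0 cospi !horner_quadratic_poly; ring.
have ends_gt0 : 0 < `|z ^+ 2 - 1|.
  have := mulr_gt0 (q_gt0 0) (q_gt0 pi); rewrite -ends exprn_even_gt0 //=.
  by rewrite normr_eq0 normr_gt0.
rewrite pzE normrM (gtr0_norm prod_gt0) normrM normrX.
have c_gt0 : 0 < `|c| by rewrite normr_gt0.
have pow_gt0 := exprn_gt0 (2 * l).+1 ends_gt0.
rewrite lnM ?posrE ?mulr_gt0 // lnM ?posrE // (ln_prod (in1W q_gt0)) -addrA.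
congr (_ + (_ + _)).
rewrite lnXn // /log_quadratic -lnM ?posrE // -ends lnXn //.
by rewrite -[LHS]mulr_natl; field.
Qed.

Lemma taylor_coef_ln_pz l n s k : gegenbauer_angles l n s -> (0 < k)%N ->
  taylor_coef 0 k (fun z => ln `|pz l.+1 n z|) =
  - ((2 * l).+1%:R * (1 + (-1) ^+ k)
     + 2 * \sum_(phi <- s) cos (k%:R * phi)) / k%:R.
Proof.
move=> /ln_pz_near0[c lnE] k_gt0; rewrite (near_eq_taylor_coef k lnE).
have sm := smooth_near_log_quadratic.
have sZ := smooth_nearM (smooth_near_cst 0 _) (smooth_nearD (sm 0) (sm pi)).
have sS := smooth_near_sum s sm.
rewrite taylor_coefD; [|exact: smooth_near_cst|exact: smooth_nearD].
rewrite taylor_coefD // taylor_coefZ; last exact: smooth_nearD.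
rewrite taylor_coefD // taylor_coef_sum // !taylor_coef_log_quadratic //.
rewrite mulr0 cos0 cos_natpi.
under eq_bigr do rewrite taylor_coef_log_quadratic //.
have k0 : k%:R != 0 :> R by rewrite pnatr_eq0 -lt0n.
rewrite -mulr_suml sumrN -mulr_sumr.
by rewrite taylor_coef_cst //; field.
Qed.

End LogTaylor.

(** * Integrals *)

Section HasIntegral.
Context {d : measure_display} {T : measurableType d} {R : realType}.
Variable mu : {measure set T -> \bar R}.
Implicit Types (D A B : set T) (f g : T -> R) (k u v : R).
Local Open Scope classical_set_scope.

Definition has_integral D f v : Prop :=
  mu.-integrable D (EFin \o f) /\ (\int[mu]_(x in D) (f x)%:E = v%:E)%E.

Lemma has_integral_unique D f u v :
  has_integral D f u -> has_integral D f v -> u = v.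
Proof. by move=> [_ fu] [_]; rewrite fu => -[]. Qed.

Lemma integrable_has_integral D f : measurable D ->
  mu.-integrable D (EFin \o f) -> exists v, has_integral D f v.
Proof.
move=> mD fi; exists (fine (\int[mu]_(x in D) (f x)%:E)%E).
by split=> //; rewrite fineK //; exact: integrable_fin_num.
Qed.

Lemma eq_has_integral D f g v : measurable D -> (forall x, D x -> f x = g x) ->
  has_integral D f v -> has_integral D g v.
Proof.
move=> mD fg [fi fv]; split.
  by apply: eq_integrable fi => // x /set_mem Dx /=; rewrite fg.
by rewrite -fv; apply: eq_integral => x /set_mem Dx; rewrite fg.
Qed.

Lemma has_integral_ae_eq D f g v : measurable D -> measurable_fun D g ->
  ae_eq mu D f g -> has_integral D f v -> has_integral D g v.
Proof.
move=> mD mg fg [fi fv].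
have mEf := measurable_int mu fi.
have mEg : measurable_fun D (EFin \o g) by exact/measurable_EFinP.
have Efg := ae_eq_comp EFin fg.
split; last by rewrite -fv; apply/esym/ae_eq_integral.
apply/integrableP; split=> //; move/integrableP : fi => [_].
congr (_ < _)%E; apply: ae_eq_integral => //; last exact: ae_eq_comp Efg.
all: exact: measurableT_comp.
Qed.

Lemma has_integralD D f g u v : measurable D ->
  has_integral D f u -> has_integral D g v ->
  has_integral D (fun x => f x + g x) (u + v).
Proof.
move=> mD [fi fu] [gi gv]; split; last by rewrite EFinD -fu -gv -integralD_EFin.
rewrite (_ : EFin \o _ = (EFin \o f) \+ (EFin \o g))%E //.
exact: integrableD.
Qed.

Lemma has_integralZ D f k v : measurable D -> has_integral D f v ->
  has_integral D (fun x => k * f x) (k * v).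
Proof.
move=> mD [fi fv]; split; last by rewrite EFinM -fv -integralZl.
rewrite (_ : EFin \o _ = (fun x => k%:E * (EFin \o f) x))%E //.
exact: integrableZl.
Qed.

Lemma has_integral_sum (I : eqType) (s : seq I) D (f : I -> T -> R)
    (v : I -> R) :
  measurable D -> {in s, forall i, has_integral D (f i) (v i)} ->
  has_integral D (fun x => \sum_(i <- s) f i x) (\sum_(i <- s) v i).
Proof.
move=> mD; elim: s => [|i s IH] fv.
  under [X in has_integral _ X]funext do rewrite big_nil.
  by rewrite big_nil; split; [exact: integrable0|rewrite integral0].
under [X in has_integral _ X]funext do rewrite big_cons.
rewrite big_cons; apply: has_integralD => //.
  by apply: fv; rewrite mem_head.
by apply: IH => j js; apply: fv; rewrite inE js orbT.
Qed.

Lemma has_integralS A B f v : measurable A -> measurable B -> A `<=` B ->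
  has_integral B f v -> exists u, has_integral A f u.
Proof.
move=> mA mB AB [fi _]; apply: integrable_has_integral => //.
exact: integrableS fi.
Qed.

Lemma integrable_mul_bounded D (h f : T -> R) (M : R) : measurable D ->
  measurable_fun D h -> (forall x, `|h x| <= M) ->
  mu.-integrable D (EFin \o f) ->
  mu.-integrable D (EFin \o (fun x => h x * f x)).
Proof.
move=> mD mh hM; apply: integrableMr => //.
exists M; split=> [|K MK x _]; first exact: num_real.
by rewrite /= (le_trans (hM x)) // ltW.
Qed.

Lemma has_integral_setU A B f u v : measurable A -> measurable B ->
  [disjoint A & B] -> has_integral A f u -> has_integral B f v ->
  has_integral (A `|` B) f (u + v).
Proof.
move=> mA mB AB [fA fu] [fB fv].
have mf : measurable_fun (A `|` B) (EFin \o f).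
  apply/measurable_funU => //.
  by split; [exact: (measurable_int mu fA)|exact: (measurable_int mu fB)].
split; last by rewrite integral_setU // fu fv.
apply/integrableP; split=> //.
rewrite integral_setU //; last exact: measurableT_comp.
by apply: lte_add_pinfty; apply/integrable_lty => //; exact: integrable_abse.
Qed.

End HasIntegral.

Section LebesgueHasIntegral.
Context {R : realType}.
Notation mu := (@lebesgue_measure R).
Implicit Types (f g : R -> R) (a b c p u v : R) (D : set R) (s : seq R).
Local Open Scope classical_set_scope.

Lemma has_integral_cat a b c f u v : a <= b <= c ->
  has_integral mu `[a, b] f u -> has_integral mu `[b, c] f v ->
  has_integral mu `[a, c] f (u + v).
Proof.
move=> /andP[ab bc] fu [fbc fv].
have acE : `[a, c] = `[a, b] `|` `]b, c] :> set R.
  by rewrite -itv_bndbnd_setU // bnd_simp.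
rewrite acE; apply: has_integral_setU => //.
  apply/disj_setPRL => x /=; rewrite !in_itv /= => /andP[bx _].
  by apply/negP; rewrite negb_and -!ltNge bx orbT.
have sub_bc : `]b, c] `<=` `[b, c] by apply: subset_itvr; rewrite bnd_simp.
split; first exact: integrableS fbc.
rewrite integral_itv_obnd_cbnd //.
exact: measurable_funS (measurable_int mu fbc).
Qed.

Lemma has_integral_subitv a b a' b' f v : a <= a' -> b' <= b ->
  has_integral mu `[a, b] f v -> exists u, has_integral mu `[a', b'] f u.
Proof.
move=> aa' bb'; apply: has_integralS => //.
by apply: subset_itv; rewrite bnd_simp.
Qed.

Lemma ae_eq_off_seq s D f g : (forall x, D x -> x \notin s -> f x = g x) ->
  ae_eq mu D f g.
Proof.
move=> fg; have s_countable : countable [set` s].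
  exact/finite_set_countable/finite_seq.
exists [set` s]; split.
- by apply: countable_measurable => // t; exact: measurable_set1.
- exact: countable_lebesgue_measure0.
move=> x /= /not_implyP[Dx fgx]; apply: contrapT => /negP xs; exact/fgx/fg.
Qed.

Section Affine.
Variables (k c : R).
Hypothesis k0 : k != 0.
Let phi (x : measurableTypeR R) : measurableTypeR R := k * x + c.

Let mphi : measurable_fun setT phi.
Proof. by apply: measurable_funD => //; exact: measurable_funM. Qed.

(* The measure structure of [pushforward mu phi] depends on [mphi], which
   canonical structure inference does not find. *)
Let nu : {measure set (measurableTypeR R) -> \bar R} :=
  mscale (NngNum (normr_ge0 k))
   (measure_function_pushforward__canonical__measure_function_Measure mu mphi).

Lemma lebesgue_measure_affine (A : set (measurableTypeR R)) :
  measurable A -> mu A = nu A.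
Proof.
apply: lebesgue_measure_unique => _ [[x y] _ <-] /=.
rewrite /nu /mscale /= /pushforward.
have [k_gt0|k_le0] := ltP 0 k.
  have -> : phi @^-1` `]x, y] = `](x - c) / k, (y - c) / k].
    apply/seteqP; split=> t /=; rewrite !in_itv /= /phi;
    by rewrite ltr_pdivrMr // ler_pdivlMr // ltrBlDr lerBrDr (mulrC t).
  rewrite !lebesgue_measure_itv /= !lte_fin ltr_pM2r ?invr_gt0 // ltrD2r.
  case: ifPn => _; last by rewrite mule0.
  by rewrite -!EFinD -EFinM gtr0_norm //; congr EFin; field.
have k_lt0 : k < 0 by rewrite lt_neqAle k0.
have -> : phi @^-1` `]x, y] = `[(y - c) / k, (x - c) / k[.
  apply/seteqP; split=> t /=; rewrite !in_itv /= /phi andbC;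
  by rewrite ltr_ndivlMr // ler_ndivrMr // ltrBlDr lerBrDr (mulrC t).
rewrite !lebesgue_measure_itv /= !lte_fin ltr_nM2r ?invr_lt0 // ltrD2r.
case: ifPn => _; last by rewrite mule0.
by rewrite -!EFinD -EFinM ltr0_norm //; congr EFin; field.
Qed.

Lemma ge0_integral_affine (h : R -> \bar R) : measurable_fun setT h ->
  (forall x, 0 <= h x)%E ->
  (\int[mu]_x h x = `|k|%:E * \int[mu]_x h (k * x + c)%R)%E.
Proof.
move=> mh h0; transitivity (\int[nu]_x h x)%E.
  by apply: eq_measure_integral => A mA _; exact: lebesgue_measure_affine.
by rewrite ge0_integral_mscale // ge0_integral_pushforward.
Qed.

Lemma integrable_affine (h : R -> \bar R) : mu.-integrable setT h ->
  mu.-integrable setT (fun x => h (k * x + c)).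
Proof.
move=> /integrableP[mh hoo]; apply/integrableP.
split; first exact: (measurableT_comp mh mphi).
rewrite ge0_integral_affine // in hoo; last exact: measurableT_comp.
move: hoo; apply: contraTT; rewrite -!leNgt !leye_eq => /eqP ->.
by rewrite gt0_muley // lte_fin normr_gt0.
Qed.

Lemma integral_affine (h : R -> \bar R) : mu.-integrable setT h ->
  (\int[mu]_x h x = `|k|%:E * \int[mu]_x h (k * x + c)%R)%E.
Proof.
move=> hi; have hi' := integrable_affine hi; have mh := measurable_int mu hi.
rewrite integralE [X in (_ = _ * X)%E]integralE.
rewrite (ge0_integral_affine (h := h^\+%E)) //; last exact: measurable_funepos.
rewrite (ge0_integral_affine (h := h^\-%E)) //; last exact: measurable_funeneg.
rewrite [RHS]muleBr //; last first.
  apply: fin_num_adde_defl; rewrite fin_numN.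
  exact: (integrable_neg_fin_num measurableT hi').
congr (_ * _ - _ * _)%E; apply: eq_integral => x _.
  by rewrite !funeposE.
by rewrite !funenegE.
Qed.

Lemma has_integral_affine D f v : measurable D -> has_integral mu D f v ->
  has_integral mu (phi @^-1` D) (fun x => f (k * x + c)) (v / `|k|).
Proof.
move=> mD [fi fv]; have mphiD : measurable (phi @^-1` D).
  by rewrite -[_ @^-1` _]setTI; exact: mphi.
pose h := (EFin \o f) \_ D.
have hphi : ((EFin \o (fun x => f (k * x + c)%R)) \_ (phi @^-1` D))%E =
    (fun x : R => h (k * x + c)).
  by apply/funext => x; rewrite /h !patchE.
have hi : mu.-integrable setT h by apply: (iffLR (integrable_mkcond _ _) fi).
split.
  apply: (iffRL (integrable_mkcond _ mphiD)).
  by rewrite hphi; exact: integrable_affine.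
rewrite integral_mkcond hphi.
have := integral_affine hi; rewrite -integral_mkcond fv.
have := integrable_fin_num measurableT (integrable_affine hi).
move: (\int[mu]_x _)%E => [I| |] // _; rewrite -EFinM => -[->].
by rewrite mulrAC divff ?mul1r // normr_eq0.
Qed.

End Affine.

Lemma has_integral_translate a b c f v : has_integral mu `[a, b] f v ->
  has_integral mu `[a - c, b - c] (fun x => f (x + c)) v.
Proof.
move=> /(has_integral_affine c (oner_neq0 R) (measurable_itv _)).
rewrite normr1 divr1; under [X in has_integral _ _ X]funext do rewrite mul1r.
rewrite (_ : _ @^-1` _ = `[a - c, b - c]) //.
by apply/seteqP; split=> x /=; rewrite !in_itv /= mul1r lerBlDr lerBrDr.
Qed.

Lemma has_integral_opp a b f v : has_integral mu `[a, b] f v ->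
  has_integral mu `[- b, - a] (fun x => f (- x)) v.
Proof.
have N1_neq0 : -1 != 0 :> R by rewrite oppr_eq0 oner_neq0.
move=> /(has_integral_affine 0 N1_neq0 (measurable_itv _)).
rewrite normrN1 divr1.
under [X in has_integral _ _ X]funext do rewrite mulN1r addr0.
rewrite (_ : _ @^-1` _ = `[- b, - a]) //.
apply/seteqP; split=> x /=;
by rewrite !in_itv /= mulN1r addr0 andbC lerNr lerNl.
Qed.

Lemma has_integral_dilate a b k f v : 0 < k -> has_integral mu `[a, b] f v ->
  has_integral mu `[a / k, b / k] (fun x => f (k * x)) (v / k).
Proof.
move=> k0 /(has_integral_affine 0 (lt0r_neq0 k0) (measurable_itv _)).
rewrite gtr0_norm //; under [X in has_integral _ _ X]funext do rewrite addr0.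
rewrite (_ : _ @^-1` _ = `[a / k, b / k]) //.
apply/seteqP; split=> x /=; rewrite !in_itv /= addr0;
by rewrite ler_pdivrMr // ler_pdivlMr // (mulrC x).
Qed.

Lemma has_integral_even a f v : 0 <= a -> (forall x, f (- x) = f x) ->
  has_integral mu `[0, a] f v -> has_integral mu `[- a, a] f (2 * v).
Proof.
move=> a0 f_even fv; have := has_integral_opp fv.
rewrite oppr0; under [X in has_integral _ _ X]funext do rewrite f_even.
move=> fv'; rewrite mulr_natl; apply: (has_integral_cat _ fv' fv).
by rewrite oppr_le0 a0.
Qed.

Lemma has_integral_odd a f v : 0 <= a -> (forall x, f (- x) = - f x) ->
  has_integral mu `[0, a] f v -> has_integral mu `[- a, a] f 0.
Proof.
move=> a0 f_odd fv.
have fNv : has_integral mu `[- a, 0] f (-1 * v).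
  have := has_integral_opp fv; rewrite oppr0 => fNv.
  apply: eq_has_integral (has_integralZ (-1) _ fNv) => // x _.
  by rewrite f_odd mulN1r opprK.
rewrite -[X in has_integral _ _ _ X](addNr v) -[- v]mulN1r.
by apply: (has_integral_cat _ fNv fv); rewrite oppr_le0 a0.
Qed.

Lemma has_integral_fold a f v : 0 <= a -> has_integral mu `[- a, a] f v ->
  has_integral mu `[0, a] (fun x => f x + f (- x)) v.
Proof.
move=> a0 fv.
have Na0 : - a <= 0 by rewrite oppr_le0.
have [u fu] := has_integral_subitv Na0 (lexx a) fv.
have [w fw] := has_integral_subitv (lexx (- a)) a0 fv.
have -> : v = u + w.
  rewrite addrC; apply: has_integral_unique fv (has_integral_cat _ fw fu).
  by rewrite Na0.
apply: has_integralD => //.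
by have := has_integral_opp fw; rewrite oppr0 opprK.
Qed.

Lemma has_integral_periodic a p c f v : 0 <= c <= p ->
  (forall x, f (x + p) = f x) -> has_integral mu `[a, a + p] f v ->
  has_integral mu `[a + c, a + c + p] f v.
Proof.
move=> /andP[c0 cp] f_periodic fv.
have ac : a <= a + c by rewrite lerDl.
have acp : a + c <= a + p by rewrite lerD2l.
have [u fu] := has_integral_subitv (lexx a) acp fv.
have [w fw] := has_integral_subitv ac (lexx (a + p)) fv.
have -> : v = w + u.
  rewrite addrC; apply: has_integral_unique fv (has_integral_cat _ fu fw).
  by rewrite ac.
apply: (has_integral_cat _ fw); first by rewrite acp lerD2r.
have := has_integral_translate (- p) fu; rewrite !opprK.
by under [X in has_integral _ _ X]funext do rewrite -f_periodic subrK.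
Qed.

End LebesgueHasIntegral.

Section FundamentalTheorem.
Context {R : realType}.
Notation mu := (@lebesgue_measure R).
Implicit Types (f F : R -> R) (a b e : R).
Local Open Scope classical_set_scope.

Lemma is_derive_continuous F (x d : R) :
  is_derive x 1 F d -> {for x, continuous F}.
Proof. by move=> [dF _]; exact/differentiable_continuous/derivable1_diffP. Qed.

Lemma within_itv_continuous a b F :
  (forall x, a <= x <= b -> {for x, continuous F}) ->
  {within `[a, b], continuous F}.
Proof.
move=> cF; apply: continuous_in_subspaceT => x; rewrite inE /= in_itv /=.
exact: cF.
Qed.

Lemma integral_derive a b f F : a < b ->
  (forall x, a <= x <= b -> {for x, continuous f}) ->
  (forall x, a <= x <= b -> is_derive x 1 F (f x)) ->
  (\int[mu]_(x in `[a, b]) (f x)%:E = (F b - F a)%:E)%E.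
Proof.
move=> ab cf dF; rewrite EFinB; apply: continuous_FTC2 => //.
- exact: within_itv_continuous.
- split=> [x| |].
  + by rewrite in_itv /= => /andP[ax xb]; have [] := dF x; rewrite ?ltW.
  + apply: cvg_at_right_filter; apply: is_derive_continuous (dF a _).
    by rewrite lexx ltW.
  + apply: cvg_at_left_filter; apply: is_derive_continuous (dF b _).
    by rewrite lexx ltW.
- move=> x; rewrite in_itv /= => /andP[ax xb]; apply/derive1_val/dF.
  by rewrite !ltW.
Qed.

(* The integrand may be unbounded at both endpoints. *)
Lemma has_integral_FTC a b f F : a < b -> mu.-integrable `[a, b] (EFin \o f) ->
  (forall x, a < x < b -> {for x, continuous f}) ->
  {within `[a, b], continuous F} ->
  (forall x, a < x < b -> is_derive x 1 F (f x)) ->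
  has_integral mu `[a, b] f (F b - F a).
Proof.
move=> ab fi cf cF dF; split=> //.
pose G x := parameterized_integral mu a x f.
have cG : {within `[a, b], continuous G}.
  exact: (parameterized_integral_continuous (ltW ab) fi).
have dG x : a < x < b -> is_derive x 1 G (f x).
  move=> /[dup] axb /andP[ax xb].
  have [dGx GxE] := continuous_FTC1_closed xb fi ax (cf x axb).
  by apply: DeriveDef; [exact: dGx|rewrite -derive1E; exact: GxE].
have [c _] : exists2 c, c \in `]a, b[%R &
    (F b - G b) - (F a - G a) = (fun=> 0) c * (b - a).
  apply: (@MVT _ (fun x => F x - G x) (fun=> 0)) => // x.
    rewrite in_itv /= => axb; rewrite -(subrr (f x)).
    by apply: is_deriveB; [exact: dF|exact: dG].
  by apply: continuousB; [exact: cF|exact: cG].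
rewrite mul0r => FG.
have Ga : G a = 0 by rewrite /G /parameterized_integral set_itv1 Rintegral_set1.
have <- : G b = F b - F a by move: FG; rewrite Ga; lra.
rewrite /G /parameterized_integral /Rintegral fineK //.
exact: integrable_fin_num.
Qed.

Lemma ge0_integrable_left_improper a b f (M : R) : a < b ->
  measurable_fun `]a, b] f -> (forall x, a < x <= b -> 0 <= f x) ->
  (forall e, a < e < b -> (\int[mu]_(x in `[e, b]) (f x)%:E <= M%:E)%E) ->
  mu.-integrable `[a, b] (EFin \o f).
Proof.
move=> ab mf f0 fM.
have mEf : measurable_fun `]a, b] (EFin \o f) by exact/measurable_EFinP.
have mabs : measurable_fun `]a, b] (abse \o (EFin \o f)).
  exact: measurableT_comp.
apply/integrableP; split; first exact/emeasurable_fun_itv_obnd_cbndP.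
rewrite -integral_itv_obnd_cbnd // itv_open_bnd_bigcup.
pose D n : set R := `[a + n.+1%:R^-1, b].
have D_sub n : D n `<=` `]a, b].
  by apply: subset_itvr; rewrite bnd_simp ltrDl invr_gt0 ltr0n.
have cvgD : (\int[mu]_(x in D n) `|(EFin \o f) x| @[n --> \oo] -->
             \int[mu]_(x in \bigcup_n D n) `|(EFin \o f) x|)%E.
  apply: ge0_nondecreasing_set_cvg_integral => // [|n|n]; last 2 first.
  - exact: measurable_itv.
  - exact: measurable_funS mabs.
  apply/nondecreasing_seqP => n; rewrite subsetEset; apply: subset_itvr.
  by rewrite bnd_simp lerD2l lef_pV2 ?posrE ?ltr0n // ler_nat.
rewrite -(cvg_lim _ cvgD) //; apply: (@le_lt_trans _ _ M%:E); last exact: ltry.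
apply: lime_le; first by apply/cvg_ex; eexists; exact: cvgD.
have ba_gt0 : 0 < b - a by rewrite subr_gt0.
near=> n; have nb : a < a + n.+1%:R^-1 < b.
  rewrite ltrDl invr_gt0 ltr0n /= -ltrBrDl.
  near: n; exact: near_infty_natSinv_lt (PosNum ba_gt0).
apply: le_trans (fM _ nb); rewrite le_eqVlt; apply/orP; left; apply/eqP.
apply: eq_integral => x; rewrite inE => /D_sub /=; rewrite in_itv /= => axb.
by rewrite ger0_norm // f0.
Unshelve. all: by end_near. Qed.

End FundamentalTheorem.

(** * Fourier coefficients of ln (2 - 2 cos u) *)

Section Trigonometry.
Context {R : realType}.
Implicit Types (k u : R) (j : nat).

Lemma is_derive_sinZ k u :
  is_derive u 1 (fun x => sin (k * x)) (k * cos (k * u)).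
Proof.
rewrite mulrC; apply: is_derive1_comp (is_derive_sin _) _.
by have := is_deriveZ k (is_derive_id u 1); rewrite [k *: 1]mulr1.
Qed.

Lemma continuous_sinZ k : continuous (fun x : R => sin (k * x)).
Proof. by move=> u; exact: is_derive_continuous (is_derive_sinZ k u). Qed.

Lemma continuous_cosZ k : continuous (fun x : R => cos (k * x)).
Proof.
move=> u; apply: (@continuous_comp _ _ _ ( *%R k) cos).
  exact: mulrl_continuous.
exact: continuous_cos.
Qed.

Lemma measurable_sinZ k : measurable_fun setT (fun x : R => sin (k * x)).
Proof. by apply: continuous_measurable_fun; exact: continuous_sinZ. Qed.

Lemma measurable_cosZ k : measurable_fun setT (fun x : R => cos (k * x)).
Proof. by apply: continuous_measurable_fun; exact: continuous_cosZ. Qed.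

Definition cos_primitive j u : R := if j is 0 then u else sin (j%:R * u) / j%:R.

Lemma is_derive_cos_primitive j u :
  is_derive u 1 (cos_primitive j) (cos (j%:R * u)).
Proof.
case: j => [|j]; first by rewrite mul0r cos0; exact: is_derive_id.
have -> : cos_primitive j.+1 = j.+1%:R^-1 *: (fun x => sin (j.+1%:R * x)).
  by apply/funext => x; rewrite /= mulrC.
apply: is_derive_eq (is_deriveZ _ (is_derive_sinZ _ _)) _.
by rewrite [_ *: _]mulKf // pnatr_eq0.
Qed.

Lemma cos_primitive0 j : cos_primitive j 0 = 0.
Proof. by case: j => [//|j]; rewrite /= mulr0 sin0 mul0r. Qed.

Lemma cos_primitive_pi j : cos_primitive j pi = (j == 0)%:R * pi.
Proof. by case: j => [|j]; rewrite /= ?mul1r // sin_natpi !mul0r. Qed.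

Lemma has_integral_cos j : has_integral lebesgue_measure `[0, pi]%classic
  (fun t : R => cos (j%:R * t)) ((j == 0)%:R * pi).
Proof.
split.
- apply: continuous_compact_integrable; first exact: segment_compact.
  exact/continuous_subspaceT/continuous_cosZ.
- have dF x (_ : 0 <= x <= pi) := is_derive_cos_primitive j x.
  rewrite (integral_derive (pi_gt0 R) _ dF) => [|x _].
    by rewrite cos_primitive0 subr0 cos_primitive_pi.
  exact: continuous_cosZ.
Qed.

Definition dirichlet_sum j u : R :=
  \sum_(i < j) (cos (i%:R * u) + cos (i.+1%:R * u)).

Definition dirichlet_primitive j u : R :=
  \sum_(i < j) (cos_primitive i u + cos_primitive i.+1 u).

Lemma is_derive_dirichlet_primitive j u :
  is_derive u 1 (dirichlet_primitive j) (dirichlet_sum j u).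
Proof.
rewrite (_ : dirichlet_primitive j =
  \sum_(i < j) (cos_primitive i + cos_primitive i.+1)).
  apply: is_derive_sum => i.
  exact: (is_deriveD (is_derive_cos_primitive i u)
                     (is_derive_cos_primitive i.+1 u)).
by apply/funext => x; rewrite fct_sumE.
Qed.

Lemma dirichlet_primitive0 j : dirichlet_primitive j 0 = 0.
Proof. by apply: big1 => i _; rewrite !cos_primitive0 addr0. Qed.

Lemma dirichlet_primitive_pi j : dirichlet_primitive j.+1 pi = pi.
Proof.
rewrite /dirichlet_primitive big_ord_recl big1 => [|i _].
  by rewrite !cos_primitive_pi mul1r mul0r !addr0.
by rewrite !cos_primitive_pi !mul0r addr0.
Qed.

Lemma dirichlet_sumE j u :
  (1 - cos u) * dirichlet_sum j u = sin u * sin (j%:R * u).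
Proof.
elim: j => [|j IH]; first by rewrite /dirichlet_sum big_ord0 mul0r sin0 !mulr0.
rewrite /dirichlet_sum big_ord_recr /= mulrDr -/(dirichlet_sum j u) IH.
rewrite -natr1 [(_ + 1) * u]mulrDl mul1r sinD cosD.
transitivity (sin u * sin (j%:R * u) * cos u
              + (1 - cos u ^+ 2) * cos (j%:R * u)); first by ring.
by rewrite -sin2cos2; ring.
Qed.

End Trigonometry.

Section MulLn.
Context {R : realType}.
Implicit Types (x : R).

Lemma norm_mulr_ln_le x : 0 <= x -> `|x * ln x| <= 1 + x ^+ 2.
Proof.
rewrite le_eqVlt => /predU1P[<-|x0]; first by rewrite mul0r normr0 expr0n addr0.
have ln_le := ltW (ln_sublinear x0).
have lnV_le : - ln x <= x^-1.
  by rewrite -lnV ?posrE // ltW // ln_sublinear ?invr_gt0.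
have {}ln_le : x * ln x <= x ^+ 2 by rewrite expr2 ler_pM2l.
have {}lnV_le : - (x * ln x) <= 1.
  by rewrite -mulrN -(divff (lt0r_neq0 x0)) ler_pM2l.
by rewrite ler_norml; apply/andP; split; nra.
Qed.

Lemma norm_sqrt_ln_le x : 0 <= x ->
  `|Num.sqrt x * ln x| <= 4 * Num.sqrt (Num.sqrt x) * (1 + Num.sqrt x).
Proof.
rewrite le_eqVlt => /predU1P[<-|x0].
  by rewrite !sqrtr0 mul0r normr0 mulr0 mul0r.
set r := Num.sqrt (Num.sqrt x).
have r0 : 0 < r by rewrite !sqrtr_gt0.
have sE : Num.sqrt x = r ^+ 2 by rewrite sqr_sqrtr ?sqrtr_ge0.
have xE : x = r ^+ 4 by rewrite (exprM r 2 2) -sE sqr_sqrtr ?ltW.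
rewrite sE {1}xE lnXn // (_ : _ * _ = 4 * r * (r * ln r)); last by ring.
rewrite normrM ger0_norm ?mulr_ge0 ?(ltW r0) //.
by rewrite ler_pM2l ?mulr_gt0 // norm_mulr_ln_le // ltW.
Qed.

End MulLn.

Section LogChord.
Context {R : realType}.
Notation mu := (@lebesgue_measure R).
Implicit Types (u phi v : R) (j : nat).

(* [2 - 2 cos u] is the squared length of the chord of the unit circle that
   subtends the angle [u]. *)
Definition log_chord u : R := ln (2 - 2 * cos u).

Lemma chord_ge0 u : 0 <= 2 - 2 * cos u.
Proof. by have := cos_le1 u; lra. Qed.

Lemma cos_lt1 u : 0 < u <= pi -> cos u < 1.
Proof.
move=> /andP[u0 upi]; rewrite -(@cos0 R) ltr_cos // in_itv /= ?lexx ?pi_ge0 //.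
by rewrite upi ltW.
Qed.

Lemma log_chordN u : log_chord (- u) = log_chord u.
Proof. by rewrite /log_chord cosN. Qed.

Lemma log_chordD2pi u : log_chord (u + pi *+ 2) = log_chord u.
Proof. by rewrite /log_chord cosD2pi. Qed.

Lemma log_chord_le4 u : log_chord u <= 4.
Proof.
have := chord_ge0 u; rewrite le_eqVlt /log_chord => /predU1P[<-|c0].
  by rewrite ln0.
by rewrite (le_trans (ltW (ln_sublinear c0))) //; have := cos_geN1 u; lra.
Qed.

Lemma log_chord_double u : sin u != 0 ->
  log_chord (2 * u) = log_chord u + log_chord (u + pi).
Proof.
move=> su; have s2 := sin2cos2 u.
have [c_gtN1 c_lt1] : -1 < cos u /\ cos u < 1.
  have : 0 < sin u ^+ 2 by rewrite exprn_even_gt0.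
  by rewrite s2; have := cos_geN1 u; have := cos_le1 u; split; nra.
rewrite /log_chord cosDpi -lnM ?posrE; [|lra|lra].
by congr ln; rewrite [2 * u]mulr_natl cos_mulr2n; ring.
Qed.

Lemma ln_sqr_cosB t phi : cos t != cos phi ->
  ln ((2 * (cos t - cos phi)) ^+ 2) = log_chord (t + phi) + log_chord (t - phi).
Proof.
move=> ne; have chordM : (2 - 2 * cos (t + phi)) * (2 - 2 * cos (t - phi)) =
    (2 * (cos t - cos phi)) ^+ 2.
  rewrite cosD cosB; have := sin2cos2 t; have := sin2cos2 phi.
  move: (cos t) (cos phi) (sin t) (sin phi) => c c' s s' s2' s2.
  transitivity (4 * ((1 - c * c') ^+ 2 - s ^+ 2 * s' ^+ 2)); first by ring.
  by rewrite s2 s2'; ring.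
have : 0 < (2 - 2 * cos (t + phi)) * (2 - 2 * cos (t - phi)).
  by rewrite chordM exprn_even_gt0 //= mulf_neq0 // subr_eq0.
have chord_gt0 : forall u, 2 - 2 * cos u != 0 -> 0 < 2 - 2 * cos u.
  by move=> u; rewrite lt0r chord_ge0 andbT.
move=> /lt0r_neq0; rewrite mulf_eq0 negb_or => /andP[/chord_gt0 ? /chord_gt0 ?].
by rewrite -chordM /log_chord lnM // posrE.
Qed.

Lemma is_derive_chord u :
  is_derive u 1 (fun x : R => 2 - 2 * cos x) (2 * sin u).
Proof.
rewrite (_ : 2 * sin u = 0 - 2 * - sin u); last by ring.
exact: is_deriveB (is_derive_cst _ _ _) (is_deriveZ 2 (is_derive_cos u)).
Qed.

Lemma continuous_chord : continuous (fun u : R => 2 - 2 * cos u).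
Proof. by move=> u; exact: is_derive_continuous (is_derive_chord u). Qed.

Lemma measurable_log_chord : measurable_fun setT log_chord.
Proof.
apply: (measurableT_comp (@measurable_ln R)).
exact: continuous_measurable_fun continuous_chord.
Qed.

Lemma is_derive_log_chord u : cos u < 1 ->
  is_derive u 1 log_chord (sin u / (1 - cos u)).
Proof.
move=> c1; have c0 : 0 < 2 - 2 * cos u by lra.
have dL := @is_derive1_comp _ (@ln R) _ u _ _
  (is_derive1_ln c0) (is_derive_chord u).
by apply: is_derive_eq; field; apply/andP; split; rewrite gt_eqF //; lra.
Qed.

Lemma norm_sin_log_chord_le u (s := Num.sqrt (2 - 2 * cos u)) :
  `|sin u * log_chord u| <= 4 * Num.sqrt s * (1 + s).
Proof.
have sin_le : `|sin u| <= s.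
  rewrite -sqrtr_sqr ler_wsqrtr // sin2cos2.
  by have [c_geN1 c_le1] := (cos_geN1 u, cos_le1 u); nra.
rewrite normrM (le_trans (ler_wpM2r (normr_ge0 _) sin_le)) //.
rewrite -[s in s * _]ger0_norm ?sqrtr_ge0 // -normrM.
exact: norm_sqrt_ln_le (chord_ge0 u).
Qed.

Lemma continuous_sin_log_chord0 :
  {for (0 : R), continuous (fun u => sin u * log_chord u)}.
Proof.
pose s u : R := Num.sqrt (2 - 2 * cos u).
pose h u := 4 * Num.sqrt (s u) * (1 + s u).
have cs : continuous s.
  move=> u; apply: continuous_comp; first exact: continuous_chord.
  exact: sqrt_continuous.
have ch : continuous h.
  move=> u; apply: cvgM; last by apply: cvgD; [exact: cvg_cst|exact: cs].
  apply: cvgM; first exact: cvg_cst.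
  by apply: continuous_comp; [exact: cs|exact: sqrt_continuous].
have h0 : h 0 = 0 by rewrite /h /s cos0 mulr1 subrr !sqrtr0 mulr0 mul0r.
have h_cvg : (h u @[u --> (0 : R)] --> (0 : R))%classic
  by have := ch 0; rewrite /continuous_at h0.
rewrite /prop_for /continuous_at sin0 mul0r.
apply: (@squeeze_cvgr _ _ _ _ (fun u => - h u) h) => //; last first.
  by have := cvgN h_cvg; rewrite oppr0; apply.
by near=> u; rewrite -ler_norml; exact: norm_sin_log_chord_le.
Unshelve. all: by end_near. Qed.

Definition cos_log_chord_primitive j u : R :=
  j%:R^-1 * (sin (j%:R * u) * log_chord u - dirichlet_primitive j u).

Lemma is_derive_cos_log_chord_primitive j u : (0 < j)%N -> cos u < 1 ->
  is_derive u 1 (cos_log_chord_primitive j) (cos (j%:R * u) * log_chord u).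
Proof.
move=> j0 c1; have j_neq0 : j%:R != 0 :> R by rewrite pnatr_eq0 -lt0n.
have dsL := is_deriveM (is_derive_sinZ j%:R u) (is_derive_log_chord c1).
have := is_deriveZ j%:R^-1 (is_deriveB dsL (is_derive_dirichlet_primitive j u)).
move=> dF; apply: is_derive_eq; rewrite /GRing.scale /=.
have c1_neq0 : 1 - cos u != 0 by rewrite gt_eqF // subr_gt0.
have -> : dirichlet_sum j u = sin u * sin (j%:R * u) / (1 - cos u).
  by rewrite -dirichlet_sumE mulrAC divff ?mul1r.
by field; rewrite j_neq0 c1_neq0.
Qed.

Lemma continuous_cos_log_chord_primitive j : (0 < j)%N ->
  {within `[0, pi], continuous (cos_log_chord_primitive j)}%classic.
Proof.
move=> j0; apply: within_itv_continuous => u /andP[].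
rewrite le_eqVlt => /predU1P[<- _|u0 upi]; last first.
  apply: is_derive_continuous (is_derive_cos_log_chord_primitive j0 _).
  by apply: cos_lt1; rewrite u0.
suff : {for (0 : R), continuous (cos_log_chord_primitive j)} by [].
apply: continuousM; first exact: cst_continuous.
apply: continuousB; last first.
  exact: is_derive_continuous (is_derive_dirichlet_primitive _ _).
have -> : (fun u => sin (j%:R * u) * log_chord u) =
    (fun u => (chebyshevU R j).[cos u] * (sin u * log_chord u)).
  by apply/funext => x; rewrite mulrA -sin_chebyshevU [_ * sin x]mulrC.
apply: continuousM; last exact: continuous_sin_log_chord0.
by apply: continuous_comp; [exact: continuous_cos|exact: continuous_horner].
Qed.

Lemma cos_log_chord_le4 u : cos u * log_chord u <= 4.
Proof.
have [c_geN1 c_le1] := (cos_geN1 u, cos_le1 u); have L_le4 := log_chord_le4 u.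
have [c_ge0|c_lt0] := leP 0 (cos u); first by nra.
have L_ge0 : 0 <= log_chord u by rewrite ln_ge0 //; lra.
by nra.
Qed.

Lemma continuous_cos_log_chord u j : cos u < 1 ->
  {for u, continuous (fun u => cos (j%:R * u) * log_chord u)}.
Proof.
move=> c1; apply: continuousM; first exact: continuous_cosZ.
exact: is_derive_continuous (is_derive_log_chord c1).
Qed.

Lemma measurable_cos_log_chord j :
  measurable_fun setT (fun u : R => cos (j%:R * u) * log_chord u).
Proof.
exact: measurable_funM (measurable_cosZ _) measurable_log_chord.
Qed.

Lemma sin_log_chord_le4 u : 0 <= u <= pi -> sin u * log_chord u <= 4.
Proof.
move=> /sin_ge0_pi s_ge0.
by have [s_le1 L_le4] := (sin_le1 u, log_chord_le4 u); nra.
Qed.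

(* [cos u * log_chord u] is bounded above, and its primitive is continuous at
   the singularity 0. *)
Lemma integrable_cos_log_chord : mu.-integrable `[0, pi]%classic
  (EFin \o (fun u => cos u * log_chord u)).
Proof.
pose g u := cos (1%:R * u) * log_chord u.
pose F u := 4 * u - cos_log_chord_primitive 1 u.
have gE u : g u = cos u * log_chord u by rewrite /g mul1r.
have fi : mu.-integrable `[0, pi]%classic (EFin \o (fun u => 4 - g u)).
  apply: (@ge0_integrable_left_improper _ _ _ _ (F pi + 4)).
  - exact: pi_gt0.
  - apply: measurable_funTS; apply: measurable_funB => //.
    exact: measurable_cos_log_chord.
  - by move=> u _; rewrite gE subr_ge0 cos_log_chord_le4.
  move=> e /andP[e0 epi].
  have c1 x : e <= x <= pi -> cos x < 1.
    by move=> /andP[ex xpi]; rewrite cos_lt1 // xpi (lt_le_trans e0).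
  have fF : (\int[mu]_(x in `[e, pi]) (4 - g x)%:E = (F pi - F e)%:E)%E.
    apply: (integral_derive epi) => x /c1 x1.
      apply: continuousB; first exact: cst_continuous.
      exact: continuous_cos_log_chord.
    have dF := is_deriveB (is_deriveZ 4 (is_derive_id x 1))
                 (is_derive_cos_log_chord_primitive (ltn0Sn 0) x1).
    by apply: is_derive_eq; rewrite [4 *: 1]mulr1.
  rewrite fF lee_fin lerD2l /F /cos_log_chord_primitive invr1 !mul1r.
  have e_itv : 0 <= e <= pi by rewrite !ltW.
  have := sin_log_chord_le4 e_itv; have := sin_ge0_pi e_itv.
  by rewrite /dirichlet_primitive big_ord1 /= mul1r divr1; lra.
have -> : EFin \o (fun u => cos u * log_chord u) =
    ((EFin \o (fun=> 4%R)) \- (EFin \o (fun u => (4 - g u)%R)))%E.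
  by apply/funext => u /=; rewrite -EFinB gE; congr EFin; ring.
apply: integrableB => //.
apply: continuous_compact_integrable; first exact: segment_compact.
by apply: continuous_subspaceT => x; exact: cst_continuous.
Qed.

Lemma integrable_log_chord :
  mu.-integrable `[0, pi]%classic (EFin \o log_chord).
Proof.
pose rest u := (1 - cos u) * log_chord u.
have rest_bound u : `|rest u| <= 9.
  have := norm_mulr_ln_le (chord_ge0 u); rewrite -/(log_chord u).
  have -> : (2 - 2 * cos u) * log_chord u = 2 * rest u by rewrite /rest; ring.
  rewrite normrM ger0_norm //; have := cos_geN1 u; have := cos_le1 u.
  by move: (cos u) `|_| => c r; nra.
have mrest : measurable_fun setT rest.
  apply: measurable_funM measurable_log_chord; apply: measurable_funB => //.
  exact: continuous_measurable_fun (@continuous_cos R).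
have rest_i : mu.-integrable `[0, pi]%classic (EFin \o rest).
  apply: measurable_bounded_integrable => //.
  - by rewrite /= lebesgue_measure_itv /= lte_fin pi_gt0 ltry.
  - exact: measurable_funTS.
  - exists 9; split=> // M M9 u _.
    by rewrite /= (le_trans (rest_bound u)) // ltW.
have -> : EFin \o log_chord =
    ((EFin \o (fun u => (cos u * log_chord u)%R)) \+ (EFin \o rest))%E.
  by apply/funext => u /=; rewrite -EFinD /rest; congr EFin; ring.
by apply: integrableD => //; exact: integrable_cos_log_chord.
Qed.

Lemma has_integral_cos_log_chord_gt0 j : (0 < j)%N ->
  has_integral mu `[0, pi]%classic (fun u => cos (j%:R * u) * log_chord u)
    (- (pi / j%:R)).
Proof.
case: j => // j _; pose F := cos_log_chord_primitive j.+1.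
have -> : - (pi / j.+1%:R) = F pi - F 0.
  rewrite /F /cos_log_chord_primitive sin_natpi dirichlet_primitive_pi.
  by rewrite dirichlet_primitive0 mulr0 sin0 !mul0r; ring.
have c1 (x : R) : 0 < x < pi -> cos x < 1.
  by move=> /andP[x0 /ltW xpi]; apply: cos_lt1; rewrite x0.
apply: has_integral_FTC.
- exact: pi_gt0.
- apply: integrable_mul_bounded (fun x => cos_max _) integrable_log_chord => //.
  exact: measurable_funTS (measurable_cosZ _).
- by move=> x /c1; exact: continuous_cos_log_chord.
- exact: continuous_cos_log_chord_primitive.
- by move=> x /c1; exact: is_derive_cos_log_chord_primitive.
Qed.

(* The duplication formula makes the integral equal to its own double. *)
Lemma has_integral_log_chord : has_integral mu `[0, pi]%classic log_chord 0.
Proof.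
have pi0 := pi_ge0 R.
have [|v Lv] := integrable_has_integral _ integrable_log_chord.
  exact: measurable_itv.
have L_reflect :
    has_integral mu `[0, pi]%classic (fun u => log_chord (u + pi)) v.
  have := has_integral_translate (- pi) (has_integral_opp Lv).
  rewrite oppr0 opprK addNr add0r; apply: eq_has_integral => // u _.
  by rewrite log_chordN -log_chordD2pi mulr2n addrA subrK.
have L_double :
    has_integral mu `[0, pi]%classic (fun u => log_chord (2 * u)) v.
  have piE : - pi + pi *+ 2 = pi :> R by rewrite mulr2n addKr.
  have := has_integral_even pi0 log_chordN Lv; rewrite -{2}piE.
  move=> /(has_integral_periodic (c := pi) _ log_chordD2pi).
  rewrite pi0 mulr2n lerDl pi0 addNr add0r => /(_ isT).
  move=> /(has_integral_dilate (ltr0n _ 2)).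
  by rewrite mul0r -mulr2n -[pi *+ 2]mulr_natl !(mulrC 2) !mulfK.
have L_sum :
    has_integral mu `[0, pi]%classic (fun u => log_chord (2 * u)) (v + v).
  apply: has_integral_ae_eq (has_integralD _ Lv L_reflect) => //.
    apply: measurable_funTS; apply: (measurableT_comp measurable_log_chord).
    exact: measurable_funM.
  apply: (@ae_eq_off_seq _ [:: 0; pi]) => u /=.
  rewrite in_itv /= => /andP[u0 upi].
  rewrite !inE negb_or => /andP[u_neq0 u_neqpi].
  rewrite log_chord_double // gt_eqF // sin_gt0_pi // !lt_neqAle u0 upi.
  by rewrite eq_sym u_neq0 u_neqpi.
have v0 : v = 0 by have := has_integral_unique L_double L_sum; lra.
by move: Lv; rewrite v0.
Qed.

(* At [j = 0] the junk value [pi / 0 = 0] is the correct one. *)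
Lemma has_integral_cos_log_chord j : has_integral mu `[0, pi]%classic
  (fun u => cos (j%:R * u) * log_chord u) (- (pi / j%:R)).
Proof.
case: j => [|j]; last exact: has_integral_cos_log_chord_gt0.
rewrite invr0 mulr0 oppr0.
apply: eq_has_integral has_integral_log_chord => // u _.
by rewrite mul0r cos0 mul1r.
Qed.

End LogChord.

Section CosineTranslates.
Context {R : realType}.
Notation mu := (@lebesgue_measure R).
Variables (f : R -> R) (j : nat) (phi K : R).
Hypothesis f_even : forall u, f (- u) = f u.
Hypothesis f_periodic : forall u, f (u + pi *+ 2) = f u.
Hypothesis f_integrable : mu.-integrable `[0, pi]%classic (EFin \o f).
Hypothesis f_cos :
  has_integral mu `[0, pi]%classic (fun u => cos (j%:R * u) * f u) K.
Hypothesis phi_itv : 0 <= phi <= pi *+ 2.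

Let has_integral_full_period :
  has_integral mu `[- pi, pi]%classic (fun u => cos (j%:R * (u - phi)) * f u)
    (2 * cos (j%:R * phi) * K).
Proof.
have pi0 := pi_ge0 R.
have [||S f_sin] := @integrable_has_integral _ _ _ mu `[0, pi]%classic
    (fun u => sin (j%:R * u) * f u).
- exact: measurable_itv.
- apply: integrable_mul_bounded (fun x => sin_max _) f_integrable => //.
  exact: measurable_funTS (measurable_sinZ _).
have cos_full : has_integral mu `[- pi, pi]%classic
    (fun u => cos (j%:R * u) * f u) (2 * K).
  by apply: has_integral_even f_cos => // u; rewrite mulrN cosN f_even.
have sin_full : has_integral mu `[- pi, pi]%classic
    (fun u => sin (j%:R * u) * f u) 0.
  by apply: has_integral_odd f_sin => // u; rewrite mulrN sinN f_even mulNr.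
have -> : 2 * cos (j%:R * phi) * K =
  cos (j%:R * phi) * (2 * K) + sin (j%:R * phi) * 0 by ring.
apply: eq_has_integral (has_integralD _ (has_integralZ _ _ cos_full)
  (has_integralZ _ _ sin_full)) => // u _.
by rewrite mulrBr cosB; ring.
Qed.

Lemma has_integral_cos_translates : has_integral mu `[0, pi]%classic
  (fun t => cos (j%:R * t) * (f (t + phi) + f (t - phi)))
  (2 * cos (j%:R * phi) * K).
Proof.
pose g u := cos (j%:R * (u - phi)) * f u.
have g_periodic u : g (u + pi *+ 2) = g u.
  rewrite /g f_periodic addrAC mulrDr; congr (_ * _).
  by rewrite [j%:R * (pi *+ 2)]mulr_natl (periodicn (@cosD2pi R)).
have period_end : - pi + pi *+ 2 = pi :> R by rewrite mulr2n addKr.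
have g_shifted : has_integral mu `[- pi + phi, - pi + phi + pi *+ 2]%classic g
    (2 * cos (j%:R * phi) * K).
  apply: has_integral_periodic => //; rewrite period_end.
  exact: has_integral_full_period.
have := has_integral_translate phi g_shifted.
rewrite [- pi + phi + _]addrAC period_end !addrK.
move=> /(has_integral_fold (pi_ge0 R)).
apply: eq_has_integral => // t _.
by rewrite /g !addrK mulrN cosN mulrDr -(f_even (t - phi)) opprB [phi - t]addrC.
Qed.

End CosineTranslates.

(** * The integrals I_m *)

Section GegenbauerIntegral.
Context {R : realType}.
Notation mu := (@lebesgue_measure R).
Implicit Types (l n m : nat) (s : seq R).

Lemma measurable_Iintegrand lam n m :
  measurable_fun setT (@Iintegrand R lam.+1 n m).
Proof.
apply: measurable_funM; first exact: measurable_cosZ.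
apply: (measurableT_comp (@measurable_ln R)).
rewrite (_ : (fun t => _) = horner (gegenbauer_poly lam n ^+ 2) \o cos).
  apply: continuous_measurable_fun => t; apply: continuous_comp.
    exact: continuous_cos.
  exact: continuous_horner.
by apply/funext => t; rewrite /= horner_exp horner_gegenbauer_poly.
Qed.

Lemma ln_sqr_gegenbauer_cos l n s t : gegenbauer_angles l n s ->
  0 <= t <= pi -> t \notin s ->
  ln (gegenbauer l.+1 n (cos t) ^+ 2) =
  2 * ln (pochhammer l.+1%:R n / n`!%:R)
  + \sum_(phi <- s) (log_chord (t + phi) + log_chord (t - phi)).
Proof.
move=> [ss s_itv sE] t_itv ts; rewrite sE.
move: (pochhammer _ _ / _) (@gegenbauer_lead_gt0 R l n) => b b0.
have cos_neq phi : phi \in s -> cos t != cos phi.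
  move=> phis; apply: contraNneq ts => /cos_inj ->; rewrite ?in_itv //=.
  by have /andP[phi_gt0 phi_ltpi] := s_itv _ phis; rewrite !ltW.
have -> : (2 ^+ n * b * \prod_(phi <- s) (cos t - cos phi)) ^+ 2 =
    b ^+ 2 * \prod_(phi <- s) (2 * (cos t - cos phi)) ^+ 2.
  rewrite prodrXl -exprMn big_split big_const_seq count_predT ss iter_mulr_1.
  by rewrite mulrA [b * _]mulrC.
have factor_gt0 phi : phi \in s -> 0 < (2 * (cos t - cos phi)) ^+ 2.
  by move=> /cos_neq ne; rewrite exprn_even_gt0 //= mulf_neq0 // subr_eq0.
rewrite lnM ?posrE ?exprn_gt0 //; last by rewrite big_seq; exact: prodr_gt0.
rewrite lnXn // -[ln b *+ 2]mulr_natl (ln_prod factor_gt0); congr (_ + _).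
by apply: eq_big_seq => phi /cos_neq; exact: ln_sqr_cosB.
Qed.

Lemma has_integral_Iintegrand l n m s : gegenbauer_angles l n s ->
  has_integral mu `[0, pi]%classic (Iintegrand l.+1 n m)
    (2 * ln (pochhammer l.+1%:R n / n`!%:R) * ((m == 0)%:R * pi)
     - 2 * (pi / (2 * m)%:R) * \sum_(phi <- s) cos ((2 * m)%:R * phi)).
Proof.
move=> sP; have [_ s_itv _] := sP.
set b := 2 * ln _; set j := (2 * m)%N.
have const_int : has_integral mu `[0, pi]%classic (fun t => b * cos (j%:R * t))
    (b * ((m == 0)%:R * pi)).
  apply: has_integralZ => //; have := @has_integral_cos R j.
  by rewrite /j muln_eq0.
have zeros_int : has_integral mu `[0, pi]%classic (fun t => \sum_(phi <- s)
    cos (j%:R * t) * (log_chord (t + phi) + log_chord (t - phi)))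
    (- (2 * (pi / j%:R) * \sum_(phi <- s) cos (j%:R * phi))).
  rewrite mulr_sumr -sumrN; apply: has_integral_sum => // phi phis.
  have /andP[phi0 phipi] := s_itv _ phis.
  rewrite (_ : - (_ * _) = 2 * cos (j%:R * phi) * - (pi / j%:R)); last by ring.
  apply: has_integral_cos_translates.
  - exact: log_chordN.
  - exact: log_chordD2pi.
  - exact: integrable_log_chord.
  - exact: has_integral_cos_log_chord.
  - by rewrite (ltW phi0) (le_trans (ltW phipi)) // mulr2n lerDl pi_ge0.
apply: has_integral_ae_eq (has_integralD _ const_int zeros_int) => //.
  by apply: measurable_funTS; exact: measurable_Iintegrand.
apply: (@ae_eq_off_seq _ s) => t /=; rewrite in_itv /= => t_itv ts.
rewrite /Iintegrand (ln_sqr_gegenbauer_cos sP) // mulrDr mulr_sumr.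
congr (_ + _); exact: mulrC.
Qed.

End GegenbauerIntegral.

Unset Implicit Arguments.

Theorem theorem1 (R : realType) (lam n : nat) (hlam : (0 < lam)%N) :
  (forall m : nat,
     (@lebesgue_measure R).-integrable `[0, pi]%classic
        (fun t => (Iintegrand lam n m t)%:E)) /\
  Imn lam n 0 = (2 * pi * ln (pochhammer (lam%:R : R) n / n`!%:R))%:E /\
  (forall m : nat, (0 < m)%N ->
     Imn lam n m =
       ((2 * lam%:R - 1) * pi / m%:R
        + pi / (2 * m)`!%:R
          * derive1n (2 * m) (fun z : R => ln `|pz lam n z|) 0)%:E).
Proof.
case: lam hlam => // l _.
have [s sP] := @gegenbauer_angles_exist R l n.
split=> [m|]; first by have [] := has_integral_Iintegrand m sP.
split=> [|m m_gt0].
  have [_] := has_integral_Iintegrand 0 sP; rewrite /Imn /Iset => ->.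
  by rewrite eqxx mul1r muln0 invr0 !mulr0 mul0r subr0 mulrAC.
have [_] := has_integral_Iintegrand m sP; rewrite /Imn /Iset => ->.
have mm_gt0 : (0 < 2 * m)%N by rewrite muln_gt0.
rewrite gtn_eqF // mul0r mulr0 [pi / _ * _]mulrAC -[_ / (2 * m)`!%:R]mulrA.
rewrite -/(taylor_coef 0 (2 * m) _) (taylor_coef_ln_pz sP mm_gt0).
have m_neq0 : m%:R != 0 :> R by rewrite pnatr_eq0 -lt0n.
rewrite exprM sqrrN !expr1n -[(2 * l).+1%:R]natr1 -[l.+1%:R]natr1 !natrM.
by congr EFin; field.
Qed.
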